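(* Let $H\in(0,3/4)$, let $T\in(0,\infty)$ be fixed, and let $G^H=\{G^H_t,\ t\ge 0\}$ be a centered Gaussian process, self-similar of index $H$, satisfying assumptions (A1), (A2), (A3) and (A4) stated in the context. Let $\sigma=(\sigma_s)_{s\in[0,T]}$ be a Hölder continuous function of order $\beta>1-H$, and let $X=\{X_t,\ t\in[0,T]\}$ be the solution of $$dX_t=-\theta X_t\,dt+\sigma_t\,dG^H_t$$ with initial condition $X_0\in\mathbb R$, where $\theta$ is a real constant. Let $QV_n(X)_t=n^{2H-1}\sum_{i=1}^{[nt]}|X_{i/n}-X_{(i-1)/n}|^2$ for $t\in[0,T]$. Then, as $n\to\infty$, $$QV_n(X)_t\longrightarrow\int_0^t|\sigma_s|^2\,ds$$ almost surely and uniformly in $t\in[0,T]$.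
   Context: All processes are defined on a probability space $(\Omega,\mathcal F,P)$; $[x]$ denotes the integer part of $x$. The stochastic differential equation means $X_t=X_0-\theta\int_0^tX_s\,ds+\int_0^t\sigma_s\,dG^H_s$, the last integral being a pathwise Riemann–Stieltjes (Young) integral. Assumptions on $G^H$: (A1) The function $d(s,t)=\mathbb E(G^H_t-G^H_s)^2$ is in $C^{1,1}$ outside the diagonal, and its mixed derivative satisfies $|\partial_{s,t}d(s,t)|=O(|t-s|^{2H-2})$. (A2) $G^H$ is Hölder continuous of order $\delta$ for any $0<\delta<H$. (A3) For integers $n,m,i\ge1$ let $I_n(i)=\{j:\ \frac jm\in(\frac{i-1}n,\frac in]\}$ (this set depends on $m$). As $m\to\infty$ (with $n,i$ fixed), $m^{-1+2H}\sum_{j\in I_n(i)}\mathbb E|G^H_{j/m}-G^H_{(j-1)/m}|^2\to\frac1n$. (A4) There exist constants $c_0,c_1$ and a function $\vartheta$ (unrelated to the drift constant $\theta$) such that for all integers $j,l\ge1$, $\mathbb E[(G^H_j-G^H_{j-1})(G^H_l-G^H_{l-1})]=c_0\rho_H(|j-l|)+c_1\vartheta(j,l)$, where $\rho_H(x)=\frac12\big[|x+1|^{2H}+|x-1|^{2H}-2|x|^{2H}\big]$ and $|\vartheta(j,l)|^2=o(1/j)$ as $j\to\infty$ (or equal to $o(1/l)$ as $l\to\infty$). *)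

(* Defs.v *)
From HB Require Import structures.
From mathcomp Require Import all_boot all_order all_algebra.
From mathcomp Require Import all_classical all_reals all_analysis.

Set Implicit Arguments.
Unset Strict Implicit.
Unset Printing Implicit Defensive.

Import Order.TTheory GRing.Theory Num.Theory.
Import numFieldNormedType.Exports.

Local Open Scope classical_set_scope.
Local Open Scope ring_scope.

(* Processes are indexed by [R]; only their values at times [t >= 0] are used. *)

(* The normal law of mean [m] and standard deviation [s].  The case [s = 0]
   is separated because the library's [normal_prob m 0] is the uniform law on
   [0, 1], not the Dirac mass at [m]. *)
Definition gaussian_law {R : realType} (m s : R) (A : set R) : \bar R :=
  if s == 0 then (\d_m A)%E else normal_prob m s A.

Definition gaussian_process {d : measure_display} {Omega : measurableType d}
    {R : realType} {P : probability Omega R} (G : R -> {RV P >-> R}) : Prop :=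
  forall (n : nat) (t a : 'I_n -> R), (forall i, 0 <= t i) ->
  exists m s : R, forall A : set R, measurable A ->
    P [set w | A (\sum_(i < n) a i * G (t i) w)] = gaussian_law m s A.

Definition centered_process {d : measure_display} {Omega : measurableType d}
    {R : realType} {P : probability Omega R} (G : R -> {RV P >-> R}) : Prop :=
  forall t : R, 0 <= t -> ('E_P[G t] = 0)%E.

(* (G_{a t})_{t >= 0} and (a^H G_t)_{t >= 0} have the same
   finite-dimensional distributions, for every a > 0. *)
Definition self_similar {d : measure_display} {Omega : measurableType d}
    {R : realType} {P : probability Omega R} (H : R) (G : R -> {RV P >-> R})
    : Prop :=
  forall (a : R) (n : nat) (t : 'I_n -> R), 0 < a -> (forall i, 0 <= t i) ->
  forall B : set (n.-tuple (measurableTypeR R)), measurable B ->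
    P [set w | B [tuple G (a * t i) w | i < n]] =
    P [set w | B [tuple a `^ H * G (t i) w | i < n]].

(* [d(s, t) = E (G_t - G_s)^2]; this is finite for a Gaussian process. *)
Definition sqincr {d : measure_display} {Omega : measurableType d}
    {R : realType} {P : probability Omega R} (G : R -> {RV P >-> R})
    (s t : R) : R :=
  fine 'E_P[fun w => ((G t w - G s w) ^+ 2)%R].

Definition pderiv1 {R : realType} (f : R -> R -> R) (s t : R) : R :=
  derive1 (fun u => f u t) s.

Definition pderiv2 {R : realType} (f : R -> R -> R) (s t : R) : R :=
  derive1 (fun u => f s u) t.

(* The open quadrant without the diagonal.  The axes are left out: for
   H < 1/2 the partial derivatives of [sqincr] may blow up there. *)
Definition offdiag {R : realType} : set (R * R) :=
  [set p | [/\ 0 < p.1, 0 < p.2 & p.1 != p.2]].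

(* Class C^{1,1} in the sense of "one continuous derivative in each of the two
   variables": the two first partial derivatives and the mixed derivative exist
   and are continuous on the open set [A]. *)
Definition C11_on {R : realType} (A : set (R * R)) (f : R -> R -> R) : Prop :=
  forall p : R * R, A p ->
  [/\ derivable (fun u => f u p.2) p.1 1,
      derivable (fun u => f p.1 u) p.2 1,
      derivable (fun u => pderiv2 f u p.2) p.1 1,
      {for p, continuous (fun q : R * R => pderiv1 f q.1 q.2)} &
      {for p, continuous (fun q : R * R => pderiv2 f q.1 q.2)} /\
      {for p, continuous (fun q : R * R => pderiv1 (pderiv2 f) q.1 q.2)}].

(* The bound is uniform over [offdiag].  For a self-similar process the mixed
   derivative is homogeneous of degree 2H - 2, so a uniform bound near the
   diagonal, or on a square (0, S]^2, amounts to the same. *)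
Definition assumptionA1 {d : measure_display} {Omega : measurableType d}
    {R : realType} {P : probability Omega R} (H : R) (G : R -> {RV P >-> R})
    : Prop :=
  C11_on offdiag (sqincr G) /\
  exists C : R, forall s t : R, offdiag (s, t) ->
    `|pderiv1 (pderiv2 (sqincr G)) s t| <= C * `|t - s| `^ (2 * H - 2).

Definition holder_on {R : realType} (A : set R) (b : R) (f : R -> R) : Prop :=
  exists C : R, forall s t, A s -> A t -> `|f t - f s| <= C * `|t - s| `^ b.

(* Hoelder continuity of almost every path on every compact interval. *)
Definition assumptionA2 {d : measure_display} {Omega : measurableType d}
    {R : realType} {P : probability Omega R} (H : R) (G : R -> {RV P >-> R})
    : Prop :=
  forall delta : R, 0 < delta < H ->
  {ae P, forall w, forall S : R, 0 < S ->
    holder_on `[0, S] delta (fun t => G t w)}.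

(* [block m n i] is the set I_n(i), whose dependence on [m] is explicit.
   It is finite for [m >= 1]. *)
Definition block {R : realType} (m n i : nat) : set nat :=
  [set j : nat | (i%:R - 1) / n%:R < j%:R / m%:R :> R /\
                 j%:R / m%:R <= i%:R / n%:R :> R].

Definition assumptionA3 {d : measure_display} {Omega : measurableType d}
    {R : realType} {P : probability Omega R} (H : R) (G : R -> {RV P >-> R})
    : Prop :=
  forall n i : nat, (1 <= n)%N -> (1 <= i)%N ->
  (m%:R `^ (- 1 + 2 * H) *
     \sum_(j \in block (R := R) m n i)
        sqincr G ((j%:R - 1) / m%:R) (j%:R / m%:R))
    @[m --> \oo] --> (n%:R^-1 : R).

Definition rho {R : realType} (H x : R) : R :=
  2^-1 * (`|x + 1| `^ (2 * H) + `|x - 1| `^ (2 * H) - 2 * `|x| `^ (2 * H)).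

(* The limits in [j] (resp. [l]) are taken for each fixed value of the other
   index; uniformity is not required. *)
Definition assumptionA4 {d : measure_display} {Omega : measurableType d}
    {R : realType} {P : probability Omega R} (H : R) (G : R -> {RV P >-> R})
    : Prop :=
  exists (c0 c1 : R) (vartheta : nat -> nat -> R),
  (forall j l : nat, (1 <= j)%N -> (1 <= l)%N ->
    'E_P[fun w => ((G j%:R w - G (j%:R - 1) w) *
                   (G l%:R w - G (l%:R - 1) w))%R]%E
    = (c0 * rho H `|j%:R - l%:R| + c1 * vartheta j l)%:E) /\
  ((forall l : nat, (1 <= l)%N ->
     (fun j : nat => `|vartheta j l| ^+ 2 : R^o)
       =o_\oo (fun j : nat => j%:R^-1 : R^o)) \/
   (forall j : nat, (1 <= j)%N ->
     (fun l : nat => `|vartheta j l| ^+ 2 : R^o)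
       =o_\oo (fun l : nat => l%:R^-1 : R^o))).

(* The points of the partition are those of [a :: s], with tag [xi i] in the
   interval of index [i]. *)
Definition RS_sum {R : realType} (f g : R -> R) (a b : R) (s : seq R)
    (xi : nat -> R) : R :=
  \sum_(0 <= i < size s)
     f (xi i) * (g (nth b (a :: s) i.+1) - g (nth b (a :: s) i)).

(* [I] is the Riemann-Stieltjes integral of [f] against [g] over [a, b]: the
   limit of tagged sums as the mesh of the partition tends to 0. *)
Definition is_RS_integral {R : realType} (f g : R -> R) (a b I : R) : Prop :=
  forall e : R, 0 < e -> exists2 del : R, 0 < del &
  forall (s : seq R) (xi : nat -> R), itv_partition a b s ->
    (forall i : nat, (i < size s)%N ->
       nth b (a :: s) i.+1 - nth b (a :: s) i < del /\
       nth b (a :: s) i <= xi i <= nth b (a :: s) i.+1) ->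
    `|RS_sum f g a b s xi - I| < e.

(* [x] solves, on [0, T], the pathwise equation
   x_t = x0 - theta \int_0^t x_s ds + \int_0^t sigma_s dg_s. *)
Definition solves_OU {R : realType} (theta : R) (sigma : R -> R) (x0 T : R)
    (g x : R -> R) : Prop :=
  {within `[0, T], continuous x} /\
  forall t : R, 0 <= t <= T ->
  exists2 I : R, is_RS_integral sigma g 0 t I &
    x t = x0 - theta * (\int[lebesgue_measure]_(s in `[0, t]) x s) + I.

Definition QV {R : realType} (H : R) (x : R -> R) (n : nat) (t : R) : R :=
  n%:R `^ (2 * H - 1) *
  \sum_(1 <= i < (Num.truncn (n%:R * t)).+1)
     `|x (i%:R / n%:R) - x ((i%:R - 1) / n%:R)| ^+ 2.

(* Main.v *)
Require Import Defs.
From HB Require Import structures.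
From mathcomp Require Import all_boot all_order all_algebra.
From mathcomp Require Import all_classical all_reals all_analysis.
From mathcomp Require Import measurable_realfun.
From mathcomp Require Import ring lra.

Set Implicit Arguments.
Unset Strict Implicit.
Unset Printing Implicit Defensive.

Import Order.TTheory GRing.Theory Num.Theory.
Import numFieldNormedType.Exports.

Local Open Scope classical_set_scope.
Local Open Scope ring_scope.

(** The theorem rests on one fact about the driving process: for each fixed
    [t >= 0], the quadratic variation [QV H G n t] tends to [t] almost surely
    ([QV_fixed_time]). Its expectation is a Cesaro mean of the variances of the
    unit steps, by self-similarity, and [assumptionA3] gives the limit. The
    centred part is controlled by its fourth moment. For centred jointly Gaussian
    variables [Y i] with covariances [r i j], the variable
    [Q = \sum_i (Y i ^+ 2 - E (Y i ^+ 2))] satisfies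
    [E (Q ^+ 4) <= 60 * (\sum_i \sum_j r i j ^+ 2) ^+ 2]
    ([centered_square_sum_moment4]), which follows from Gaussian integration by
    parts alone.

    The covariances of unit steps come from two sources. Away from the diagonal,
    [assumptionA1] and the mean value theorem give [r i j = O(`|i - j| ^ (2 H - 2))],
    and [H < 3 / 4] makes the squares [O(1 / `|i - j|)]. Near the diagonal and
    for the first step, the variance of a step is compared with the Hoelder
    continuity of the paths: if a centred Gaussian variable is below a level with
    probability more than one half, its standard deviation is at most a multiple
    of that level ([gaussian_small_ball], [sqincr_near1]). The sum of the [M^2]
    squares is then [O(M^(1 + 3 / 8))], the fourth moment of the centred
    quadratic variation is [O(n^(- 5 / 4))], and summability gives almost sure
    convergence.

    The remaining argument concerns one path. The exponents satisfy
    [beta + delta > 1] for some [delta < H], so Young's estimate shows that an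
    increment of [X] over a step of length [1 / n] equals [sigma] times the
    increment of [G] up to [O(1 / n)] ([solution_increment]). Since [H < 1] this
    error does not contribute to the limit ([QV_solution_cvg]). The squared
    increments of [G], seen as measures, converge to the Lebesgue measure on a
    countable family of intervals, so their integrals of the continuous function
    [`|sigma| ^+ 2] converge ([weighted_QV_cvg]). Finally the quadratic variation
    is monotone in time and its limit is Lipschitz, so convergence on a
    countable dense set of times is uniform ([monotone_grid_uniform]). *)

(** * Integration against a measure with a density *)

Section density.
Context {d : measure_display} {T : measurableType d} {R : realType}.
Context (mu nu : {measure set T -> \bar R}) (g : T -> R).
Hypotheses (mg : measurable_fun setT g) (g_ge0 : forall x, 0 <= g x).
Hypothesis nuE : forall A, measurable A ->
  nu A = (\int[mu]_(x in A) (g x)%:E)%E.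

Import HBNNSimple.

Let nnsfun_density (f : {nnsfun T >-> R}) :
  (\int[nu]_x (f x)%:E = \int[mu]_x ((f x)%:E * (g x)%:E))%E.
Proof.
rewrite integralT_nnsfun sintegralE.
under [RHS]eq_integral => x _.
  rewrite (fimfunE f x) -fsumEFin// ge0_mule_fsuml; last first.
    by move=> r; rewrite EFinM nnfun_muleindic_ge0.
  over.
rewrite ge0_integral_fsum//; last 2 first.
- move=> r; apply: emeasurable_funM; last exact/measurable_EFinP.
  exact/measurable_EFinP/measurableT_comp.
- move=> r x _; apply: mule_ge0; last by rewrite lee_fin.
  by rewrite EFinM nnfun_muleindic_ge0.
apply: eq_fsbigr => r; rewrite inE => -[x _ <-].
rewrite nuE//; under [RHS]eq_integral do rewrite EFinM -muleA.
have h0 x0 : (0 <= (\1_(f @^-1` [set f x]) x0)%:E * (g x0)%:E :> \bar R)%E.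
  by rewrite mule_ge0// lee_fin.
rewrite ge0_integralZl// ?lee_fin//; last first.
  apply: emeasurable_funM; last exact/measurable_EFinP.
  exact/measurable_EFinP/measurable_indic.
congr (_ * _)%E; rewrite [LHS]integral_mkcond; apply: eq_integral => y _.
by rewrite patchE indicE; case: ifPn => _; rewrite ?mul1e ?mul0e.
Qed.

Lemma ge0_integral_density (f : T -> \bar R) : measurable_fun setT f ->
  (forall x, 0 <= f x)%E ->
  (\int[nu]_x f x = \int[mu]_x (f x * (g x)%:E))%E.
Proof.
move=> mf f0; pose f_ := nnsfun_approx measurableT mf.
have ndf x m n : (m <= n)%N -> (f_ m x <= f_ n x)%R.
  by move=> mn; exact/lefP/nd_nnsfun_approx.
have cvf x : ((f_ n x)%:E @[n --> \oo] --> f x)%E by exact: cvg_nnsfun_approx.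
transitivity (limn (fun n => \int[nu]_x (f_ n x)%:E)%E).
  rewrite -monotone_convergence//=.
  - by apply: eq_integral => x _; apply/esym/cvg_lim.
  - by move=> n; exact/measurable_EFinP.
  - by move=> n ? _; rewrite lee_fin.
  - by move=> x _ m n mn; rewrite lee_fin ndf.
under eq_fun do rewrite nnsfun_density.
rewrite -monotone_convergence//=.
- apply: eq_integral => x _; apply/cvg_lim => //.
  by apply: cvgeZr.
- by move=> n; apply: emeasurable_funM; exact/measurable_EFinP.
- by move=> n x _; rewrite mule_ge0// lee_fin.
- by move=> x _ m n mn; rewrite lee_pmul// ?lee_fin// ndf.
Qed.

Lemma integral_density (f : T -> \bar R) : measurable_fun setT f ->
  (\int[nu]_x f x = \int[mu]_x (f x * (g x)%:E))%E.
Proof.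
move=> mf; rewrite [LHS]integralE [RHS]integralE.
rewrite (_ : (fun x => f x * (g x)%:E)^\+ = (fun x => f^\+ x * (g x)%:E))%E; last first.
  apply/funext => x; rewrite !funeposE muleC [RHS]muleC maxe_pMr ?lee_fin//.
  by rewrite mule0.
rewrite (_ : (fun x => f x * (g x)%:E)^\- = (fun x => f^\- x * (g x)%:E))%E; last first.
  apply/funext => x; rewrite !funenegE muleC -muleN [RHS]muleC maxe_pMr ?lee_fin//.
  by rewrite mule0.
by rewrite !ge0_integral_density//; [exact: measurable_funeneg|exact: measurable_funepos].
Qed.

Lemma integrable_density (f : T -> \bar R) : measurable_fun setT f ->
  mu.-integrable setT (fun x => f x * (g x)%:E)%E -> nu.-integrable setT f.
Proof.
move=> mf /integrableP[_ fg]; apply/integrableP; split => //.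
rewrite ge0_integral_density//; last exact: measurableT_comp.
by under eq_integral do rewrite -[(g _)%:E]gee0_abs ?lee_fin// -abseM.
Qed.

End density.

(** * Moments of the normal law *)

(** Both boundary terms of the fundamental theorem of calculus on [[- n, n]]
    vanish in the limit. *)
Lemma integral_derivative_eq0 {R : realType} (F f : R -> R) :
  lebesgue_measure.-integrable setT (EFin \o f) ->
  continuous f -> (forall x : R, is_derive x 1 F (f x)) ->
  F n%:R @[n --> \oo] --> (0 : R) -> F (- n%:R) @[n --> \oo] --> (0 : R) ->
  \int[lebesgue_measure]_x f x = 0.
Proof.
move=> intf cf dF Fp Fm.
pose D n := `[(- n.+1%:R : R), n.+1%:R]%classic.
have mD n : measurable (D n) by exact: measurable_itv.
have FTC n : (\int[lebesgue_measure]_(x in D n) (f x)%:E =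
    (F n.+1%:R - F (- n.+1%:R))%:E)%E.
  rewrite EFinB; apply: continuous_FTC2.
  - by rewrite gtrN.
  - exact: continuous_subspaceT.
  - split.
    + by move=> x _; case: (dF x).
    + apply: cvg_at_right_filter; apply: differentiable_continuous.
      by apply/derivable1_diffP; case: (dF (- n.+1%:R)).
    + apply: cvg_at_left_filter; apply: differentiable_continuous.
      by apply/derivable1_diffP; case: (dF (n.+1%:R)).
  - by move=> x _; rewrite derive1E; case: (dF x).
have cv : (\int[lebesgue_measure]_(x in D n) (f x)%:E @[n --> \oo]
    --> \int[lebesgue_measure]_x (f x)%:E)%E.
  under eq_fun do rewrite integral_mkcond.
  apply: (@dominated_cvg _ _ _ (@lebesgue_measure R) _ measurableT
    (fun n => (fun x => (f x)%:E) \_ (D n)) (fun x => (f x)%:E)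
    (fun x => `|(f x)%:E|%E)).
  - move=> n; apply/(measurable_restrictT (fun x => (f x)%:E)) => //.
    by apply: measurable_funTS; exact: measurable_int intf.
  - move=> x _; apply: cvg_near_cst; near=> n; rewrite patchE mem_set//.
    rewrite /D /= in_itv/= -ler_norml; apply: ltW.
    apply: (@lt_le_trans _ _ n%:R); last by rewrite ler_nat.
    near: n; exact: nbhs_infty_gtr.
  - by [].
  - exact: integrable_abse.
  - by move=> n x _; rewrite patchE; case: ifPn => _; rewrite ?abse0.
have cv0 : ((F n.+1%:R - F (- n.+1%:R))%:E @[n --> \oo] --> 0%:E)%E.
  apply: cvg_EFin; first by near=> n.
  rewrite -(subrr (0 : R)); apply: cvgB.
    by rewrite (cvg_shiftS (fun n => F n%:R)).
  by rewrite (cvg_shiftS (fun n => F (- n%:R))).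
rewrite /Rintegral.
rewrite (_ : (\int[lebesgue_measure]_x (f x)%:E)%E = 0%:E)//.
rewrite -(cvg_lim _ cv)//; apply/cvg_lim => //.
by under eq_fun do rewrite FTC.
Unshelve. all: by end_near. Qed.

Section normal_moments.
Context {R : realType} (m s : R) (s0 : s != 0).
Local Notation mu := (@lebesgue_measure R).

(** Doubling the standard deviation leaves room for every power. With
    [z = (x - m)^2 / (8 s^2)] the two exponentials are [e^(- 4 z)] and
    [e^(- z)], while a power of [`|x - m|] is at most a multiple of [e^z].
    This gives the integrability of the moments and the decay at infinity that
    the integration by parts below needs. *)
Lemma normal_fun_absorbs_power (k : nat) : exists2 C : R, 0 <= C &
  forall x, `|x - m| ^+ k * normal_fun m s x <= C * normal_fun m (2 * s) x.
Proof.
have s2 : 0 < s ^+ 2 by rewrite exprn_even_gt0.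
pose C := 1 + (8 * s ^+ 2) ^+ k * k`!%:R : R.
have C0 : 0 <= C by rewrite addr_ge0// mulr_ge0// exprn_ge0// mulr_ge0// ltW.
exists C => // x; pose y := x - m; pose z := y ^+ 2 / (8 * s ^+ 2).
have z0 : 0 <= z by rewrite divr_ge0 ?sqr_ge0// mulr_ge0// ltW.
have -> : normal_fun m s x = expR (- (4 * z)).
  rewrite /normal_fun /z -/y; congr expR; field.
  exact: s0.
have -> : normal_fun m (2 * s) x = expR (- z).
  rewrite /normal_fun /z -/y; congr expR; field.
  exact: s0.
have yz : `|y| ^+ k <= C * expR z.
  have y1 : `|y| ^+ k <= 1 + (y ^+ 2) ^+ k.
    have [y1|y1] := leP `|y| 1.
      by rewrite (@le_trans _ _ 1)// ?exprn_ile1// lerDl exprn_ge0// sqr_ge0.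
    rewrite (@le_trans _ _ (`|y| ^+ (2 * k)))//.
      by rewrite ler_eXn2l// mul2n -addnn leq_addr.
    by rewrite exprM real_normK ?num_real// lerDr.
  apply: (le_trans y1).
  have -> : y ^+ 2 = 8 * s ^+ 2 * z by rewrite /z mulrC divfK// gt_eqF// mulr_gt0.
  rewrite exprMn /C [leRHS]mulrDl mul1r; apply: lerD.
    by rewrite -expR0 ler_expR.
  rewrite -mulrA; apply: ler_wpM2l; first by rewrite exprn_ge0// mulr_ge0// ltW.
  case: k {C C0 y1} => [|k].
    by rewrite expr0 fact0 mul1r -expR0 ler_expR.
  rewrite mulrC -ler_pdivrMr ?ltr0n ?fact_gt0//.
  by rewrite (le_trans _ (expR_ge1Dxn k z0))// lerDr.
apply: (@le_trans _ _ (C * expR z * expR (- (4 * z)))).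
  by rewrite ler_wpM2r ?expR_ge0.
by rewrite -mulrA -expRD ler_wpM2l// ler_expR; lra.
Qed.

Lemma integrable_normal_moment (k : nat) :
  mu.-integrable setT (fun x => ((x - m) ^+ k * normal_pdf m s x)%:E).
Proof.
have [C C0 CP] := normal_fun_absorbs_power k.
have s20 : 2 * s != 0 by rewrite mulf_neq0.
pose c := normal_peak s * C / normal_peak (2 * s).
have c0 : 0 <= c.
  by rewrite divr_ge0 ?normal_peak_ge0// mulr_ge0 ?normal_peak_ge0.
have ig : mu.-integrable setT (fun x => (c * normal_pdf m (2 * s) x)%:E).
  under eq_fun do rewrite EFinM.
  by apply: integrableZl => //; exact: integrable_normal_pdf.
apply: le_integrable ig => //=.
- apply/measurable_EFinP; apply: measurable_funM.
    by apply: measurable_funX; exact: measurable_funB.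
  exact: measurable_normal_pdf.
- move=> x _; rewrite lee_fin normrM normrX [`|normal_pdf _ _ _|]ger0_norm.
    rewrite [leRHS]ger0_norm; last by rewrite mulr_ge0// normal_pdf_ge0.
    rewrite !normal_pdfE// mulrCA /c.
    rewrite [leRHS](_ : _ = normal_peak s * (C * normal_fun m (2 * s) x)).
      by rewrite ler_wpM2l ?normal_peak_ge0.
    by rewrite -2!mulrA mulKf// gt_eqF// normal_peak_gt0.
  exact: normal_pdf_ge0.
Qed.

Let dnormal_pdf (x : R) : is_derive x (1 : R) (normal_pdf m s)
  (- (x - m) / s ^+ 2 * normal_pdf m s x).
Proof.
rewrite normal_pdfE//.
have d1 : is_derive x (1 : R) (fun x => - (x - m) ^+ 2 / (s ^+ 2 *+ 2))
   (- (x - m) / s ^+ 2).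
  have -> : (fun x => - (x - m) ^+ 2 / (s ^+ 2 *+ 2)) =
    cst (- (s ^+ 2 *+ 2)^-1) * (id - cst m) ^+ 2 :> (R -> R).
    by apply/funext => y; rewrite !fctE/= mulrC mulNr mulrN.
  apply: is_derive_eq; rewrite !fctE/= /GRing.scale/=; field.
  exact: s0.
have d2 := is_derive1_comp (is_derive_expR _) d1.
have d3 := is_deriveZ (normal_peak s) d2.
by apply: is_derive_eq; rewrite /GRing.scale/= /normal_fun; ring.
Qed.

Let dF (k : nat) (x : R) : is_derive x (1 : R)
  (fun x => (x - m) ^+ k * normal_pdf m s x)
  ((x - m) ^+ k.-1 * normal_pdf m s x *+ k -
   (x - m) ^+ k.+1 * normal_pdf m s x / s ^+ 2).
Proof.
have d0 := dnormal_pdf x.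
have d1 : is_derive x (1 : R) (id - cst m) 1.
  by apply: is_derive_eq; rewrite subr0.
have d2 := is_deriveM (is_deriveX k d1) d0.
have -> : (fun x => (x - m) ^+ k * normal_pdf m s x) =
    (id - cst m) ^+ k * normal_pdf m s by apply/funext => y; rewrite !fctE.
apply: (is_derive_eq d2); rewrite !fctE/= /GRing.scale/=.
by rewrite [(x - m) ^+ k.+1]exprS -[_ *+ k]mulr_natr; field.
Qed.

Let continuous_F (k : nat) : continuous (fun x => (x - m) ^+ k * normal_pdf m s x).
Proof.
move=> x; apply: differentiable_continuous; apply/derivable1_diffP.
by case: (dF k x).
Qed.

Let F_cvg0 (k : nat) (u : nat -> R) : (forall n, n%:R - `|m| <= `|u n - m|) ->
  (u n - m) ^+ k * normal_pdf m s (u n) @[n --> \oo] --> (0 : R).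
Proof.
move=> um; have [C C0 CP] := normal_fun_absorbs_power k.+1.
apply/cvgr0Pnorm_lt => e e0.
have pC0 : 0 <= normal_peak s * C by rewrite mulr_ge0// normal_peak_ge0.
near=> n.
have nm : normal_peak s * C / e < `|u n - m|.
  apply: (lt_le_trans _ (um n)); rewrite ltrBrDr.
  by near: n; exact: nbhs_infty_gtr.
have um0 : 0 < `|u n - m| by rewrite (le_lt_trans _ nm)// divr_ge0// ltW.
rewrite normrM normrX [`|normal_pdf _ _ _|]ger0_norm ?normal_pdf_ge0//.
rewrite -(ltr_pM2l um0) mulrA -exprS normal_pdfE// mulrCA.
rewrite ltr_pdivrMr// in nm; apply: le_lt_trans nm.
rewrite ler_wpM2l ?normal_peak_ge0// (le_trans (CP _))// ler_piMr//.
rewrite /normal_fun -expR0 ler_expR mulNr oppr_le0 divr_ge0 ?sqr_ge0//.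
by rewrite mulrn_wge0// sqr_ge0.
Unshelve. all: by end_near. Qed.

(** The difference of the two integrands is the derivative of [(x - m)^k]
    times the density, which vanishes at infinity. *)
Let integral_dF_eq0 (k : nat) :
  (\int[mu]_x ((x - m) ^+ k.-1 * normal_pdf m s x)) *+ k =
  (\int[mu]_x ((x - m) ^+ k.+1 * normal_pdf m s x)) / s ^+ 2.
Proof.
have i1 := integrable_normal_moment k.-1.
have i2 := integrable_normal_moment k.+1.
have i1' : mu.-integrable setT
    (fun x => (k%:R * ((x - m) ^+ k.-1 * normal_pdf m s x))%:E).
  by under eq_fun do rewrite EFinM; exact: integrableZl.
have i2' : mu.-integrable setT
    (fun x => ((s ^+ 2)^-1 * ((x - m) ^+ k.+1 * normal_pdf m s x))%:E).
  by under eq_fun do rewrite EFinM; exact: integrableZl.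
apply/eqP; rewrite -subr_eq0 -mulr_natl [X in _ - X]mulrC.
rewrite -!RintegralZl// -RintegralB//.
apply/eqP; apply: (@integral_derivative_eq0 _
  (fun x => (x - m) ^+ k * normal_pdf m s x)).
- exact: (integrableB measurableT i1' i2').
- by move=> x; apply: cvgB; apply: cvgMr; exact: continuous_F.
- by move=> x; have := dF k x; rewrite mulr_natl [_ / _]mulrC.
- apply: F_cvg0 => n; rewrite (le_trans _ (lerB_dist _ _))//.
  by rewrite normr_nat.
- apply: F_cvg0 => n; rewrite -opprD normrN (le_trans _ (lerB_normD _ _))//.
  by rewrite normr_nat.
Qed.

Lemma normal_moment_rec (k : nat) :
  \int[mu]_x ((x - m) ^+ k.+2 * normal_pdf m s x) =
  s ^+ 2 * k.+1%:R * \int[mu]_x ((x - m) ^+ k * normal_pdf m s x).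
Proof.
have := integral_dF_eq0 k.+1 => /esym/(canRL (divfK _)) ->.
  by rewrite -[_ *+ _]mulr_natl mulrC mulrA.
by rewrite expf_neq0.
Qed.

Lemma normal_first_moment :
  \int[mu]_x ((x - m) * normal_pdf m s x) = 0.
Proof.
have := integral_dF_eq0 0; rewrite /= mulr0n => /esym/(canRL (divfK _)).
by rewrite mul0r; apply; rewrite expf_neq0.
Qed.

End normal_moments.

(** * Random variables with a Gaussian law *)

Lemma measurable_fun_RV {d : measure_display} {Omega : measurableType d}
  {R : realType} (P : probability Omega R) (X : Omega -> R) :
  measurable_fun setT X ->
  exists Y : {RV P >-> measurableTypeR R}, (Y : Omega -> R) = X.
Proof.
move=> mX; pose Z : Omega -> measurableTypeR R := X.
have mZ : measurable_fun setT Z by exact: mX.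
by exists (mfun_Sub (mem_set mZ)).
Qed.

Section gaussian_variable.
Context {d : measure_display} {Omega : measurableType d} {R : realType}
  (P : probability Omega R) (X : Omega -> R) (m s : R).
Hypothesis mX : measurable_fun setT X.
Hypothesis lawX : forall A : set R, measurable A ->
  P [set w | A (X w)] = gaussian_law m s A.

Let degenerate : s = 0 -> {ae P, forall w, X w = m}.
Proof.
move=> s0; exists [set w | (~` [set m]) (X w)]; split => //.
- by rewrite -[X in measurable X]setTI; apply: mX => //; exact: measurableC.
- rewrite lawX; last exact: measurableC.
  by rewrite /gaussian_law s0 eqxx diracE memNset//= => -[].
Qed.

(** A nondegenerate Gaussian law has a density, so expectations of functions
    of [X] are Lebesgue integrals. *)
Let transfer (f : R -> R) : s != 0 -> measurable_fun setT f ->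
  lebesgue_measure.-integrable setT (fun x => (f x * normal_pdf m s x)%:E) ->
  P.-integrable setT (fun w => (f (X w))%:E) /\
  \int[P]_w (f (X w)) = \int[lebesgue_measure]_x (f x * normal_pdf m s x).
Proof.
move=> s0 mf fi; have [Y YX] := measurable_fun_RV P mX.
have law A : measurable A -> distribution P Y A = normal_prob m s A.
  by move=> mA; rewrite /distribution /pushforward YX lawX// /gaussian_law (negbTE s0).
have mEf : @measurable_fun _ _ (measurableTypeR R) _ setT (EFin \o f).
  exact/measurable_EFinP.
have nuE A : measurable A -> distribution P Y A =
    (\int[lebesgue_measure]_(x in A) (normal_pdf m s x)%:E)%E.
  by move=> mA; rewrite law.
have mp : @measurable_fun _ _ (measurableTypeR R) _ setT (normal_pdf m s).
  exact: measurable_normal_pdf.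
have p0 (x : measurableTypeR R) := normal_pdf_ge0 m s x.
have iY : (distribution P Y).-integrable setT (EFin \o f).
  exact: (integrable_density mp p0 nuE mEf fi).
have iX : P.-integrable setT (fun w => (f (X w))%:E).
  have /integrableP[_ lt] := iY.
  apply/integrableP; split.
    by apply/measurable_EFinP; exact: measurableT_comp.
  rewrite -YX; have := @ge0_integral_distribution _ _ _ _ _ P Y (fun x => `|(f x)%:E|%E).
  move=> <- //; exact: measurableT_comp.
split => //; rewrite /Rintegral; congr fine.
have := integral_density mp p0 nuE mEf => /= <-.
by rewrite integral_distribution ?YX.
Qed.

Lemma gaussian_moment_integrable (k : nat) :
  P.-integrable setT (fun w => ((X w - m) ^+ k)%:E).
Proof.
have [s0|s0] := eqVneq s 0; last first.
  apply: (transfer (f := fun x => (x - m) ^+ k) s0 _ _).1.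
    by apply: measurable_funX; exact: measurable_funB.
  exact: integrable_normal_moment.
apply/integrableP; split.
  apply/measurable_EFinP; apply: measurable_funX; exact: measurable_funB.
rewrite (ae_eq_integral (fun=> (`|((0 : R) ^+ k)%:E|)%E))//.
- by have /integrableP[] := @finite_measure_integrable_cst _ _ _ P setT ((0 : R) ^+ k) measurableT.
- apply: measurableT_comp => //.
  by apply/measurable_EFinP; apply: measurable_funX; exact: measurable_funB.
- by apply: filterS (degenerate s0) => w -> _; rewrite subrr.
Qed.

Lemma gaussian_moment_rec (k : nat) :
  \int[P]_w ((X w - m) ^+ k.+2) =
  s ^+ 2 * k.+1%:R * \int[P]_w ((X w - m) ^+ k).
Proof.
have mk j : measurable_fun setT (fun x : R => (x - m) ^+ j).
  by apply: measurable_funX; exact: measurable_funB.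
have [s0|s0] := eqVneq s 0; last first.
  rewrite (transfer s0 (mk _) (integrable_normal_moment _ s0 _)).2.
  rewrite (transfer s0 (mk _) (integrable_normal_moment _ s0 _)).2.
  exact: normal_moment_rec.
rewrite s0 expr0n !mul0r /Rintegral (ae_eq_integral (fun=> 0%E))//.
- by rewrite integral0.
- by apply/measurable_EFinP; apply: measurable_funX; exact: measurable_funB.
- by apply: filterS (degenerate s0) => w -> _; rewrite subrr expr0n.
Qed.

Lemma gaussian_mean : \int[P]_w X w = m.
Proof.
suff : \int[P]_w (X w - m) = 0.
  rewrite RintegralB//.
  - by rewrite Rintegral_cst//= probability_setT mulr1 => /eqP; rewrite subr_eq0 => /eqP.
  - have := integrableD measurableT (gaussian_moment_integrable 1)
      (finite_measure_integrable_cst P m measurableT).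
    by apply: eq_integrable => // w _; rewrite /= expr1 -EFinD subrK.
  - exact: finite_measure_integrable_cst.
have [s0|s0] := eqVneq s 0; last first.
  have [| |_ ->] := transfer (f := fun x => x - m) s0.
  - exact: measurable_funB.
  - exact: (integrable_normal_moment m s0 1).
  - exact: normal_first_moment.
rewrite /Rintegral (ae_eq_integral (fun=> 0%E))//.
- by rewrite integral0.
- by apply/measurable_EFinP; exact: measurable_funB.
- by apply: filterS (degenerate s0) => w -> _; rewrite subrr.
Qed.

(** A normal density is at most [1 / (`|s| sqrt (2 pi))]. An interval of length
    [2 a] that carries more than half of the mass therefore forces
    [`|s| sqrt (2 pi) < 4 a]. *)
Lemma gaussian_small_ball (a : R) :
  (2^-1%:E < P [set w | (`|X w - m| <= a)%R])%E -> s ^+ 2 <= 16 * a ^+ 2.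
Proof.
move=> Pa; have [->|s0] := eqVneq s 0.
  by rewrite expr0n mulr_ge0// sqr_ge0.
have a0 : 0 <= a.
  rewrite leNgt; apply/negP => a0; move: Pa.
  rewrite (_ : [set w | _] = set0) ?measure0 ?lte_fin ?invr_lt0 ?ltrn0//.
  by rewrite -subset0 => w /=; rewrite leNgt (lt_le_trans a0).
have p0 := normal_peak_gt0 s0.
have : (P [set w | (`|X w - m| <= a)%R] <= (normal_peak s * (2 * a))%:E)%E.
  have := lawX (A := `[m - a, m + a]%classic).
  rewrite (_ : [set w | `[m - a, m + a]%classic (X w)] = [set w | `|X w - m| <= a]); last first.
    by apply/seteqP; split => w /=; rewrite in_itv/= ler_distl.
  move=> -> //; rewrite /gaussian_law (negbTE s0) /normal_prob.
  apply: (@le_trans _ _ (\int[lebesgue_measure]_(x in `[(m - a)%R, (m + a)%R]) (normal_peak s)%:E)%E).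
    apply: ge0_le_integral => //=.
    - by move=> x _; rewrite lee_fin normal_pdf_ge0.
    - by apply/measurable_EFinP/measurable_funTS; exact: measurable_normal_pdf.
    - by move=> x _; rewrite lee_fin normal_pdf_ub.
  rewrite integral_cst//= lebesgue_measure_itv/= lte_fin.
  case: ifPn => _; last by rewrite mule0 lee_fin mulr_ge0 ?mulr_ge0// ltW.
  by rewrite -EFinB -EFinM lee_fin ler_pM2l//; lra.
move=> /(lt_le_trans Pa); rewrite lte_fin /normal_peak.
set q := Num.sqrt _ => h.
have q0 : 0 < q by move: p0; rewrite /normal_peak invr_gt0.
have q4 : q < 4 * a.
  by move: h; rewrite mulrC ltr_pdivlMr// mulrC ltr_pdivrMr//; lra.
have : q ^+ 2 <= 16 * a ^+ 2.
  have -> : 16 * a ^+ 2 = (4 * a) ^+ 2 by ring.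
  by rewrite lerXn2r ?nnegrE ?mulr_ge0// ltW.
apply: le_trans; rewrite /q sqr_sqrtr; last first.
  by rewrite mulrn_wge0// mulr_ge0 ?sqr_ge0 ?pi_ge0.
rewrite -mulrnAr ler_peMr ?sqr_ge0// mulr2n.
by have := @pi_ge2 R; lra.
Qed.

End gaussian_variable.

(** * Random variables with moments of all orders *)

Section all_moments.
Context {d : measure_display} {Omega : measurableType d} {R : realType}
  (P : probability Omega R).
Implicit Types F G : Omega -> R.

(** Unlike plain integrability, this condition is closed under products, so
    polynomials in Gaussian variables can be expanded under the expectation
    without further integrability proofs. *)
Definition all_moments F :=
  forall k : nat, P.-integrable setT (fun w => (F w ^+ k)%:E).

Definition expect F : R := \int[P]_w F w.

Lemma all_moments_integrable F : all_moments F ->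
  P.-integrable setT (EFin \o F).
Proof. by move=> /(_ 1). Qed.

Lemma all_moments_measurable F : all_moments F -> measurable_fun setT F.
Proof. by move=> /all_moments_integrable/measurable_int/measurable_EFinP. Qed.

Lemma all_moments_cst (c : R) : all_moments (cst c).
Proof. by move=> k; exact: (finite_measure_integrable_cst P (c ^+ k)). Qed.

Lemma all_momentsX F k : all_moments F -> all_moments (F ^+ k).
Proof. by move=> mF j; under eq_fun do rewrite fctE -exprM; exact: mF. Qed.

Let integrableM F G : all_moments F -> all_moments G ->
  P.-integrable setT (EFin \o (F * G)).
Proof.
move=> mF mG; have := integrableD measurableT (mF 2) (mG 2).
apply: le_integrable => //.
  apply/measurable_EFinP.
  by apply: measurable_funM; exact: all_moments_measurable.
move=> w _; rewrite /= fctE lee_fin normrM [leRHS]ger0_norm ?addr_ge0 ?sqr_ge0//.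
rewrite -[F w ^+ 2]real_normK ?num_real// -[G w ^+ 2]real_normK ?num_real//.
have /= := sqr_ge0 (`|F w| - `|G w|).
have /= := mulr_ge0 (normr_ge0 (F w)) (normr_ge0 (G w)); nra.
Qed.

Lemma all_momentsM F G : all_moments F -> all_moments G -> all_moments (F * G).
Proof.
move=> mF mG k; under eq_fun do rewrite fctE exprMn.
have := integrableM (all_momentsX k mF) (all_momentsX k mG).
by apply: eq_integrable => // w _; rewrite /= !fctE.
Qed.

Lemma all_momentsD F G : all_moments F -> all_moments G -> all_moments (F + G).
Proof.
move=> mF mG k; under eq_fun do rewrite fctE exprDn -sumEFin.
apply: integrable_sum => // i _.
have mC : all_moments (cst 'C(k, i)%:R) by exact: all_moments_cst.
have := integrableM (all_momentsM (all_momentsX (k - i) mF) (all_momentsX i mG)) mC.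
by apply: eq_integrable => // w _; rewrite /= !fctE mulr_natr.
Qed.

Lemma all_momentsN F : all_moments F -> all_moments (- F).
Proof.
move=> mF; have := all_momentsM (all_moments_cst (-1)) mF.
by rewrite (_ : cst (-1) * F = - F)//; apply/funext => w; rewrite !fctE mulN1r.
Qed.

Lemma all_momentsB F G : all_moments F -> all_moments G -> all_moments (F - G).
Proof. by move=> mF mG; apply: all_momentsD => //; exact: all_momentsN. Qed.

Lemma all_moments_sum (I : Type) (r : seq I) (p : pred I) (F : I -> Omega -> R) :
  (forall i, p i -> all_moments (F i)) -> all_moments (\sum_(i <- r | p i) F i).
Proof.
move=> mF; elim/big_ind : _ => //; first exact: (all_moments_cst 0).
exact: all_momentsD.
Qed.

Lemma expect_cst c : expect (cst c) = c.
Proof. by rewrite /expect Rintegral_cst//= probability_setT mulr1. Qed.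

Lemma expectD F G : all_moments F -> all_moments G ->
  expect (F + G) = expect F + expect G.
Proof. by move=> mF mG; exact: (RintegralD _ (mF 1) (mG 1)). Qed.

Lemma expectZ c F : all_moments F -> expect (cst c * F) = c * expect F.
Proof. by move=> mF; exact: (RintegralZl _ _ (mF 1)). Qed.

Lemma expectB F G : all_moments F -> all_moments G ->
  expect (F - G) = expect F - expect G.
Proof. by move=> mF mG; exact: (RintegralB _ (mF 1) (mG 1)). Qed.

Lemma expect_sum (I : Type) (r : seq I) (p : pred I) (F : I -> Omega -> R) :
  (forall i, p i -> all_moments (F i)) ->
  expect (\sum_(i <- r | p i) F i) = \sum_(i <- r | p i) expect (F i).
Proof.
move=> mF; elim: r => [|i r ih]; first by rewrite !big_nil (expect_cst 0).
rewrite !big_cons; case: ifPn => // pi.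
rewrite expectD ?ih//; [exact: mF|exact: all_moments_sum].
Qed.

Lemma expect_ge0 F : (forall w, 0 <= F w) -> 0 <= expect F.
Proof. by move=> F0; apply: Rintegral_ge0. Qed.

(** A moment along a line is a polynomial in [t]. An identity between such
    moments can thus be differentiated at [t = 0] by comparing coefficients,
    without differentiating under the expectation. *)
Lemma expect_line_poly (F u x : Omega -> R) (m : nat) :
  all_moments F -> all_moments u -> all_moments x ->
  exists p : {poly R}, [/\ forall t, expect (F * (u + cst t * x) ^+ m) = p.[t],
    p`_0 = expect (F * u ^+ m) &
    p`_1 = m%:R * expect (F * u ^+ m.-1 * x)].
Proof.
move=> mF mu mx.
have mT i : all_moments (F * u ^+ (m - i) * x ^+ i).
  apply: all_momentsM; last exact: all_momentsX.
  by apply: all_momentsM => //; exact: all_momentsX.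
exists (\poly_(i < m.+1) ('C(m, i)%:R * expect (F * u ^+ (m - i) * x ^+ i))).
split.
- move=> t; rewrite horner_poly exprDn mulr_sumr.
  rewrite (eq_bigr (fun i : 'I_m.+1 =>
    cst ('C(m, i)%:R * t ^+ i) * (F * u ^+ (m - i) * x ^+ i))); last first.
    move=> i _; rewrite -mulr_natr exprMn.
    have -> : cst ('C(m, i)%:R * t ^+ i) = 'C(m, i)%:R * cst t ^+ i :> (Omega -> R).
      by apply/funext => w; rewrite natmulfctE !fctE.
    by ring.
  rewrite expect_sum => [|i _]; last first.
    by apply: all_momentsM => //; exact: all_moments_cst.
  by apply: eq_bigr => i _; rewrite expectZ// mulrAC.
- by rewrite coef_poly/= bin0 mul1r subn0 expr0 mulr1.
- rewrite coef_poly; case: m {mT} => [|m]; first by rewrite /= mul0r.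
  by rewrite /= bin1 subn1 /= expr1.
Qed.

End all_moments.

Lemma poly_fun_inj {R : realFieldType} (p q : {poly R}) :
  (forall t, p.[t] = q.[t]) -> p = q.
Proof.
move=> pq; apply/eqP; rewrite -subr_eq0; apply/negPn/negP => pq0.
have := @max_poly_roots _ (p - q) [seq n%:R | n <- iota 0 (size (p - q))] pq0.
rewrite size_map size_iota ltnn => h; suff : false by []; apply: h.
  by apply/allP => _ /mapP[n _ ->]; rewrite rootE !hornerE pq subrr.
rewrite map_inj_uniq ?iota_uniq// => m n /eqP.
by rewrite eqr_nat => /eqP.
Qed.

(** * Gaussian integration by parts *)

Lemma cst0_mul (T : Type) (R : pzRingType) (F : T -> R) : cst 0 * F = 0.
Proof. exact: mul0r. Qed.

Lemma cst1_mul (T : Type) (R : pzRingType) (F : T -> R) : cst 1 * F = F.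
Proof. exact: mul1r. Qed.

Section stein.
Context {d : measure_display} {Omega : measurableType d} {R : realType}
  (P : probability Omega R).
Local Notation E := (expect P).

(** A centred Gaussian space, described by the moments of single variables
    only: by polarization this determines all joint moments. The recursion also
    covers the variables of variance zero. *)
Record gaussian_space (S : set (Omega -> R)) : Prop := GaussianSpace {
  gsD : forall u v, S u -> S v -> S (u + v);
  gsZ : forall c u, S u -> S (cst c * u);
  gs_moments : forall u, S u -> all_moments P u;
  gs_mean : forall u, S u -> E u = 0;
  gs_rec : forall u (k : nat), S u ->
    E (u ^+ k.+2) = k.+1%:R * E (u ^+ 2) * E (u ^+ k) }.

Context (S : set (Omega -> R)) (gS : gaussian_space S).

Let cov u v := E (u * v).

Let Smom u : S u -> all_moments P u. Proof. exact: gs_moments gS u. Qed.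

Let momM F G := @all_momentsM _ _ _ P F G.
Let momX F k := @all_momentsX _ _ _ P F k.

Let line u x t : S u -> S x -> S (u + cst t * x).
Proof. by move=> Su Sx; apply: gsD gS _ _ Su _; exact: gsZ. Qed.

Let var_line u x t : S u -> S x ->
  E ((u + cst t * x) ^+ 2) = E (u ^+ 2) + 2 * cov u x * t + E (x ^+ 2) * t ^+ 2.
Proof.
move=> Su Sx; have mu := Smom Su; have mx := Smom Sx.
have -> : (u + cst t * x) ^+ 2 =
    u ^+ 2 + (cst (2 * t) * (u * x) + cst (t ^+ 2) * x ^+ 2).
  have -> : cst (2 * t) = 2 * cst t :> (Omega -> R).
    by apply/funext => w; rewrite !fctE natmulfctE.
  have -> : cst (t ^+ 2) = cst t ^+ 2 :> (Omega -> R) by apply/funext => w; rewrite !fctE.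
  by ring.
rewrite !expectD ?expectZ//; [rewrite /cov; ring|..];
  do ?[exact: all_moments_cst | exact: momX | apply: momM | apply: all_momentsD] => //.
Qed.

(** Polarization of the moment recursion: compare the coefficients of [t] in
    the recursion written for [u + t v]. *)
Lemma gaussian_mul_power v u (m : nat) : S v -> S u ->
  E (v * u ^+ m) = m%:R * E (v * u) * E (u ^+ m.-1).
Proof.
move=> Sv Su; have mv := Smom Sv; have mu := Smom Su.
move: m; apply: ltn_ind => -[|[|m]] ih.
- by rewrite expr0 mulr1 mul0r mul0r (gs_mean gS).
- by rewrite expr1 mul1r expr0 (_ : 1 = cst 1)// expect_cst mulr1.
have m1 : all_moments P (cst 1) by exact: all_moments_cst.
have [p [pE _ p1]] := expect_line_poly m.+3 m1 mu mv.
have [q [qE q0 q1]] := expect_line_poly m.+1 m1 mu mv.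
rewrite !cst1_mul in q0 q1 p1.
have : p = (m.+2%:R)%:P * ((E (u ^+ 2))%:P + (2 * cov u v)%:P * 'X + (E (v ^+ 2))%:P * 'X^2) * q.
  apply: poly_fun_inj => t; rewrite -pE !hornerE -qE !cst1_mul.
  rewrite (gs_rec gS); last exact: line.
  by rewrite var_line// expr2 mulrA.
move=> /(congr1 (fun r : {poly R} => r`_1)); rewrite p1.
rewrite -mulrA coefCM.
set a := E (u ^+ 2); set b := 2 * _; set c := E (v ^+ 2).
have -> : ((a%:P + b%:P * 'X + c%:P * 'X^2) * q)`_1 = a * q`_1 + b * q`_0.
  rewrite !mulrDl !coefD -[_ * 'X * q]mulrA -[_ * 'X^2 * q]mulrA !coefCM.
  by rewrite coefXM coefXnM /= mulr0 addr0.
rewrite q0 q1 /=.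
have mC : E (u ^+ m * v) = m%:R * E (v * u) * E (u ^+ m.-1).
  by rewrite mulrC ih// ltnW.
have mCC : E (u ^+ m.+2 * v) = E (v * u ^+ m.+2) by rewrite mulrC.
rewrite mC mCC /a /b /cov [u * v]mulrC => h.
have rec : a * (m%:R * E (u ^+ m.-1)) = E (u ^+ m.+1).
  rewrite /a; case: (m) => [|k] /=.
    by rewrite mul0r mulr0 expr1 (gs_mean gS).
  by rewrite (gs_rec gS k Su) mulrCA mulrA.
apply: (mulfI (_ : m.+3%:R != 0)); first by rewrite pnatr_eq0.
rewrite h.
transitivity (m.+2%:R * (m.+1%:R * E (v * u) * (a * (m%:R * E (u ^+ m.-1))) + 2 * E (v * u) * E (u ^+ m.+1))).
  rewrite /a; ring.
rewrite rec; set w := E (u ^+ m.+1); set e := E (v * u).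
by rewrite -[m.+3%:R]natr1 -[m.+1%:R]natr1 -[m.+2%:R]natr1 -[m.+1%:R]natr1; ring.
Qed.

(** Gaussian integration by parts. When [F] is a polynomial in the variables of
    [S], [D] is its derivative in the direction [v], the derivative of [x]
    being the covariance of [v] and [x]. Testing the relation against the powers
    of one variable [u], instead of testing only the case [m = 0], is what makes
    it stable under multiplication of [F] by an element of [S]. *)
Definition stein v (F D : Omega -> R) : Prop :=
  [/\ S v, all_moments P F, all_moments P D &
   forall u (m : nat), S u ->
     E (v * F * u ^+ m) =
     E (D * u ^+ m) + m%:R * E (v * u) * E (F * u ^+ m.-1)].

Lemma stein1 v : S v -> stein v (cst 1) (cst 0).
Proof.
move=> Sv; split => //; try exact: all_moments_cst.
move=> u m Su.
rewrite [v * _]mulrC !cst1_mul cst0_mul (expect_cst P 0) add0r.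
exact: gaussian_mul_power.
Qed.

(** The product rule. The relation for [u + t x] and the power [m + 1] is
    polynomial in [t]; its coefficient of degree 1 is the relation for [x F],
    up to the factor [m + 1]. *)
Lemma stein_mul v x F D : S x -> stein v F D ->
  stein v (x * F) (x * D + cst (E (v * x)) * F).
Proof.
move=> Sx [Sv mF mD st]; have mv := Smom Sv; have mx := Smom Sx.
split => //; first exact: momM.
  apply: all_momentsD; first exact: momM.
  by apply: momM => //; exact: all_moments_cst.
move=> u m Su; have mu := Smom Su.
have mvF : all_moments P (v * F) by exact: momM.
have [p [pE p0 p1]] := expect_line_poly m.+1 mvF mu mx.
have [q [qE q0 q1]] := expect_line_poly m.+1 mD mu mx.
have [r [rE r0 r1]] := expect_line_poly m mF mu mx.
have mvu : all_moments P (v * u) by exact: momM.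
have mvx : all_moments P (v * x) by exact: momM.
have : p = q + (m.+1%:R)%:P * ((E (v * u))%:P + (E (v * x))%:P * 'X) * r.
  apply: poly_fun_inj => t; rewrite -pE !hornerE -qE -rE.
  rewrite st; last exact: line.
  rewrite mulrDr mulrCA expectD ?expectZ//; last first.
    by apply: momM => //; exact: all_moments_cst.
  by rewrite [t * _]mulrC.
move=> /(congr1 (fun r : {poly R} => r`_1)).
rewrite coefD -mulrA coefCM mulrDl coefD -mulrA !coefCM coefXM/= p1 q1 r0 r1.
move=> h; apply: (mulfI (_ : m.+1%:R != 0)); first by rewrite pnatr_eq0.
have -> : v * (x * F) * u ^+ m = v * F * u ^+ m * x by ring.
rewrite h /=.
have -> : (x * D + cst (E (v * x)) * F) * u ^+ m =
   D * u ^+ m * x + cst (E (v * x)) * (F * u ^+ m) by ring.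
have -> : x * F * u ^+ m.-1 = F * u ^+ m.-1 * x by ring.
rewrite expectD ?expectZ; [ring|..];
  do ?[exact: all_moments_cst | exact: momX | apply: momM | apply: all_momentsD] => //.
Qed.

Lemma steinD v F D G D' : stein v F D -> stein v G D' ->
  stein v (F + G) (D + D').
Proof.
move=> [Sv mF mD st] [_ mG mD' st']; have mv := Smom Sv.
split => //; try exact: all_momentsD.
move=> u m Su; have mu := Smom Su.
rewrite mulrDr !mulrDl !expectD ?st ?st'//; [ring|..];
  by do ?[exact: momX | apply: momM].
Qed.

Lemma steinZ c v F D : stein v F D -> stein v (cst c * F) (cst c * D).
Proof.
move=> [Sv mF mD st]; have mv := Smom Sv.
split => //; try by apply: momM => //; exact: all_moments_cst.
move=> u m Su; have mu := Smom Su.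
rewrite mulrCA -!mulrA !expectZ ?mulrA ?st//; [ring|..];
  by do ?[exact: momX | apply: momM].
Qed.

Lemma stein_sum (I : Type) (r : seq I) v (F D : I -> Omega -> R) : S v ->
  (forall i, stein v (F i) (D i)) ->
  stein v (\sum_(i <- r) F i) (\sum_(i <- r) D i).
Proof.
move=> Sv st; elim: r => [|i r ih]; last by rewrite !big_cons; exact: steinD.
rewrite !big_nil; have := steinZ 0 (stein1 Sv).
by rewrite !cst0_mul.
Qed.

Lemma stein_expect v F D : stein v F D -> E (v * F) = E D.
Proof.
move=> [Sv mF mD st]; have := st v 0%N Sv.
by rewrite !mulr1 !mul0r addr0.
Qed.

End stein.

(** * Fourth moment of a centred sum of Gaussian squares *)

Section fourth_moment.
Context {d : measure_display} {Omega : measurableType d} {R : realType}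
  (P : probability Omega R).
Local Notation E := (expect P).
Context (S : set (Omega -> R)) (gS : gaussian_space P S).
Context (M : nat) (Y : 'I_M -> Omega -> R) (SY : forall i, S (Y i)).
Local Notation stein := (stein P S).

Let r i j := E (Y i * Y j).

(** The centring constants are multiples of [cst 1] because this is the form in
    which [steinD] and [steinZ] produce them. *)
Definition centered_square_sum : Omega -> R :=
  \sum_(i < M) (Y i * Y i + cst (- E (Y i * Y i)) * cst 1).

Local Notation Q := centered_square_sum.

(** Half of the derivative of [centered_square_sum] in the direction [v]. *)
Definition cov_average (v : Omega -> R) : Omega -> R :=
  \sum_(j < M) cst (E (v * Y j)) * Y j.

Local Notation A := cov_average.

Let mY i : all_moments P (Y i). Proof. exact: gs_moments gS _ (SY i). Qed.

Let mc c : all_moments P (cst c). Proof. exact: all_moments_cst. Qed.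

Let momM F G := @all_momentsM _ _ _ P F G.

Let S0 : (exists v, S v) -> S 0.
Proof. by case=> v Sv; have := gsZ gS 0 Sv; rewrite cst0_mul. Qed.

Let SA v : S v -> S (A v).
Proof.
move=> Sv; rewrite /A; elim/big_rec : _ => [|i F _ SF]; first by apply: S0; exists v.
by apply: (gsD gS) => //; exact: (gsZ gS).
Qed.

Let mQ : all_moments P Q.
Proof.
by apply: all_moments_sum => i _; apply: all_momentsD; exact: momM.
Qed.

Lemma steinQ v F D : stein v F D -> stein v (Q * F) (Q * D + 2 * (A v * F)).
Proof.
move=> st; have [Sv mF mD _] := st.
have := stein_sum gS (index_enum 'I_M) (F := fun i => Y i * (Y i * F) + cst (- r i i) * F)
  (D := fun i => (Y i * (Y i * D + cst (E (v * Y i)) * F) + cst (E (v * Y i)) * (Y i * F)) + cst (- r i i) * D) Sv.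
have -> : \sum_i (Y i * (Y i * F) + cst (- r i i) * F) = Q * F.
  rewrite mulr_suml; apply: eq_bigr => i _.
  by rewrite mulrDl -!mulrA cst1_mul.
have -> : \sum_i (Y i * (Y i * D + cst (E (v * Y i)) * F) + cst (E (v * Y i)) * (Y i * F) +
     cst (- r i i) * D) = Q * D + 2 * (A v * F).
  rewrite !mulr_suml mulr_sumr -big_split/=; apply: eq_bigr => i _.
  rewrite -/(r i i) (_ : cst 1 = 1)//; ring.
apply=> i; apply: (steinD gS); last exact: (steinZ gS).
by apply: (stein_mul gS) => //; exact: (stein_mul gS).
Qed.

(** The product rule applied to [Y i * F] creates [E (Y i * Y i)] times [F];
    the centring removes exactly this term. *)
Lemma expect_Q_mul F (D : 'I_M -> Omega -> R) : all_moments P F ->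
  (forall i, stein (Y i) F (D i)) -> E (Q * F) = \sum_i E (Y i * D i).
Proof.
move=> mF st.
rewrite mulr_suml expect_sum => [|i _]; last first.
  by apply: momM => //; apply: all_momentsD; exact: momM.
apply: eq_bigr => i _; have [_ _ mD _] := st i.
rewrite mulrDl -!mulrA cst1_mul expectD ?expectZ//; last 2 first.
- by do 2 apply: momM => //.
- exact: momM.
rewrite (stein_expect (stein_mul gS (SY i) (st i))) expectD ?expectZ//.
- by rewrite mulNr addrK.
- exact: momM.
- exact: momM.
Qed.

Let st1 i : stein (Y i) (cst 1) (cst 0). Proof. exact: stein1. Qed.

Let EQ0 : E Q = 0.
Proof.
have := expect_Q_mul (mc 1) st1; rewrite [Q * _]mulrC cst1_mul => ->.
by apply: big1 => i _; rewrite mulrC cst0_mul (expect_cst P 0).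
Qed.

Let stQ v : S v -> stein v Q (2 * A v).
Proof.
move=> Sv; have := steinQ (stein1 gS Sv).
rewrite (_ : cst 0 = 0)// (_ : cst 1 = 1)//.
by rewrite mulr0 add0r !mulr1.
Qed.

Let S2 := \sum_i \sum_j r i j ^+ 2.

Let cst2 (F : Omega -> R) : 2 * F = cst 2 * F.
Proof. by congr (_ * _); apply/funext => w; rewrite natmulfctE. Qed.

Let m2 : all_moments P 2.
Proof. by have := mc 2; rewrite -[cst 2]mulr1 -cst2 mulr1. Qed.

Let mA i : all_moments P (A (Y i)).
Proof. by apply: gs_moments gS _ _; exact: SA. Qed.

Let EYA i j : E (Y i * A (Y j)) = \sum_k r j k * r i k.
Proof.
rewrite mulr_sumr expect_sum => [|k _]; last by do 2 apply: momM => //.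
by apply: eq_bigr => k _; rewrite mulrCA expectZ//; exact: momM.
Qed.

Let expect_centered_square_sum2 : E (Q * Q) = 2 * S2.
Proof.
rewrite (expect_Q_mul mQ (fun i => stQ (SY i))) mulr_sumr; apply: eq_bigr => i _.
rewrite mulrCA cst2 expectZ; last exact: momM.
by rewrite EYA; congr (_ * _); apply: eq_bigr => j _; rewrite expr2.
Qed.

Let EAA i j : E (A (Y i) * A (Y j)) = \sum_k \sum_l r i k * r j l * r k l.
Proof.
rewrite mulr_suml expect_sum => [|k _]; last by do 2 apply: momM => //.
apply: eq_bigr => k _; rewrite -mulrA expectZ; last exact: momM.
rewrite EYA mulr_sumr; apply: eq_bigr => l _.
by rewrite mulrA.
Qed.

Let EYYQQ i j : E (Y i * (Y j * (Q * Q))) =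
  8 * E (A (Y i) * A (Y j)) + r i j * (2 * S2).
Proof.
have := stein_expect (stein_mul gS (SY j) (steinQ (stQ (SY i)))) => ->.
have -> : Y j * (Q * (2 * A (Y i)) + 2 * (A (Y i) * Q)) + cst (E (Y i * Y j)) * (Q * Q) =
  cst 4 * (Y j * (A (Y i) * Q)) + cst (r i j) * (Q * Q).
  have -> : cst 4 = 4 :> (Omega -> R) by apply/funext => w; rewrite natmulfctE.
  by rewrite /r; ring.
rewrite expectD ?expectZ; do ?[apply: momM => //].
rewrite (stein_expect (stein_mul gS (SA (SY i)) (stQ (SY j)))).
rewrite expectD ?expectZ ?EQ0//; do ?[apply: momM => //].
rewrite mulrCA cst2 expectZ; last exact: momM.
rewrite expect_centered_square_sum2 mulr0 addr0.
by move: (E _) (r i j) S2 => a b c; ring.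
Qed.

Let expect_centered_square_sum4 : E (Q ^+ 4) =
  6 * \sum_i \sum_j r i j * (8 * E (A (Y i) * A (Y j)) + r i j * (2 * S2)).
Proof.
have -> : Q ^+ 4 = Q * (Q * (Q * Q)) by ring.
rewrite (expect_Q_mul (momM mQ (momM mQ mQ)) (fun i => steinQ (steinQ (stQ (SY i))))).
rewrite [RHS]mulr_sumr; apply: eq_bigr => i _.
have -> : Y i * (Q * (Q * (2 * A (Y i)) + 2 * (A (Y i) * Q)) + 2 * (A (Y i) * (Q * Q))) =
  cst 6 * (A (Y i) * (Y i * (Q * Q))).
  have -> : cst 6 = 6 :> (Omega -> R) by apply/funext => w; rewrite natmulfctE.
  by ring.
rewrite expectZ; last by do ?[apply: momM => //].
congr (_ * _); rewrite mulr_suml expect_sum => [|j _]; last by do ?[apply: momM => //].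
apply: eq_bigr => j _; rewrite -mulrA expectZ; last by do ?[apply: momM => //].
by rewrite mulrCA EYYQQ.
Qed.

(** With [r] the covariance matrix and [S2] the sum of the squares of its
    entries, repeated integration by parts gives
    [E (Q ^+ 4) = 48 tr (r ^+ 4) + 12 S2 ^+ 2]. The trace is the sum of
    [r i j * r i k * r j l * r k l], and pairing the factors as
    [(r i j * r k l) * (r i k * r j l)] bounds it by [S2 ^+ 2]. *)
Lemma centered_square_sum_moment4 :
  E (Q ^+ 4) <= 60 * (\sum_i \sum_j E (Y i * Y j) ^+ 2) ^+ 2.
Proof.
rewrite -/S2.
rewrite expect_centered_square_sum4.
have S20 : 0 <= S2 by apply: sumr_ge0 => i _; apply: sumr_ge0 => j _; exact: sqr_ge0.
have S2S2 : S2 ^+ 2 = \sum_i \sum_j \sum_k \sum_l r i j ^+ 2 * r k l ^+ 2.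
  rewrite expr2 mulr_suml; apply: eq_bigr => i _; rewrite mulr_suml.
  apply: eq_bigr => j _; rewrite mulr_sumr; apply: eq_bigr => k _.
  by rewrite mulr_sumr.
have S2S2' : S2 ^+ 2 = \sum_i \sum_j \sum_k \sum_l r i k ^+ 2 * r j l ^+ 2.
  rewrite expr2 mulr_suml; apply: eq_bigr => i _; rewrite exchange_big.
  rewrite mulr_suml; apply: eq_bigr => j _.
  rewrite mulr_sumr; apply: eq_bigr => k _.
  by rewrite mulr_sumr.
have bound : \sum_i \sum_j r i j * E (A (Y i) * A (Y j)) <= S2 ^+ 2.
  have -> : S2 ^+ 2 = 2^-1 * (S2 ^+ 2 + S2 ^+ 2) by field.
  rewrite {1}S2S2 S2S2' -big_split/= mulr_sumr; apply: ler_sum => i _.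
  rewrite -big_split/= mulr_sumr; apply: ler_sum => j _.
  rewrite EAA -big_split/= !mulr_sumr; apply: ler_sum => k _.
  rewrite -big_split/= !mulr_sumr; apply: ler_sum => l _.
  have := sqr_ge0 (r i j * r k l - r i k * r j l).
  by rewrite sqrrB !exprMn; lra.
have -> : \sum_i \sum_j r i j * (8 * E (A (Y i) * A (Y j)) + r i j * (2 * S2)) =
  8 * \sum_i \sum_j r i j * E (A (Y i) * A (Y j)) + 2 * S2 ^+ 2.
  have -> : 2 * S2 ^+ 2 = (\sum_i \sum_j r i j ^+ 2) * (2 * S2).
    by rewrite -/S2; ring.
  rewrite mulr_suml [8 * _]mulr_sumr -big_split/=; apply: eq_bigr => i _.
  rewrite mulr_suml [8 * _]mulr_sumr -big_split/=; apply: eq_bigr => j _.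
  by move: (E _) (r i j) S2 => a b c; ring.
by move: bound; move: (\sum_i _) (S2 ^+ 2) => a b; lra.
Qed.

End fourth_moment.

(** * The Gaussian space of a Gaussian process *)

Section gaussian_span.
Context {d : measure_display} {Omega : measurableType d} {R : realType}
  (P : probability Omega R) (G : R -> {RV P >-> R}).
Local Notation E := (expect P).
Hypotheses (G_gaussian : gaussian_process G) (G_centered : centered_process G).

Definition gaussian_span : set (Omega -> R) :=
  [set f | exists (n : nat) (t a : 'I_n -> R), (forall i, 0 <= t i) /\
    f = \sum_(i < n) cst (a i) * (G (t i) : Omega -> R)].

Lemma gaussian_spanD u v :
  gaussian_span u -> gaussian_span v -> gaussian_span (u + v).
Proof.
move=> [n [t [a [t0 ->]]]] [m [t' [a' [t0' ->]]]].
pose glue (x : 'I_n -> R) (y : 'I_m -> R) (i : 'I_(n + m)) : R :=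
  match fintype.split i with inl j => x j | inr j => y j end.
exists (n + m)%N, (glue t t'), (glue a a'); split.
  by move=> i; rewrite /glue; case: (fintype.split i).
rewrite big_split_ord; congr (_ + _); apply: eq_bigr => i _; rewrite /glue.
  by rewrite (unsplitK (inl i)).
by rewrite (unsplitK (inr i)).
Qed.

Lemma gaussian_spanZ c u : gaussian_span u -> gaussian_span (cst c * u).
Proof.
move=> [n [t [a [t0 ->]]]]; exists n, t, (fun i => c * a i); split => //.
rewrite mulr_sumr; apply: eq_bigr => i _.
by apply/funext => w; rewrite !fctE mulrA.
Qed.

Lemma gaussian_span_RV t : 0 <= t -> gaussian_span (G t).
Proof.
move=> t0; exists 1%N, (fun=> t), (fun=> 1); split => //.
by rewrite big_ord1 cst1_mul.
Qed.

Lemma gaussian_spanB u v :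
  gaussian_span u -> gaussian_span v -> gaussian_span (u - v).
Proof.
move=> Su Sv; rewrite -mulN1r; apply: gaussian_spanD => //.
exact: (gaussian_spanZ (-1)).
Qed.

Let law u : gaussian_span u -> measurable_fun setT u /\ exists m s : R,
  forall A : set R, measurable A -> P [set w | A (u w)] = gaussian_law m s A.
Proof.
move=> [n [t [a [t0 ->]]]]; have uE w : (\sum_(i < n) cst (a i) * (G (t i) : Omega -> R)) w =
    \sum_(i < n) a i * G (t i) w by rewrite fct_sumE; apply: eq_bigr.
split.
  rewrite (_ : \sum_(i < n) _ = fun w => \sum_(i < n) a i * G (t i) w); last exact/funext.
  by apply: measurable_sum => i; exact: measurable_funM.
have [m [s h]] := G_gaussian a t0; exists m, s => A mA.
by rewrite -h//; under eq_set do rewrite uE.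
Qed.

Let moments u : gaussian_span u -> all_moments P u.
Proof.
move=> /law[mu [m [s lawu]]].
have -> : u = (u - cst m) + cst m by rewrite subrK.
apply: all_momentsD; last exact: all_moments_cst.
move=> k; have := gaussian_moment_integrable mu lawu k.
by apply: eq_integrable => // w _; rewrite !fctE.
Qed.

Let mean u : gaussian_span u -> E u = 0.
Proof.
move=> [n [t [a [t0 ->]]]]; rewrite expect_sum => [|i _]; last first.
  apply: all_momentsM; first exact: all_moments_cst.
  by apply: moments; exact: gaussian_span_RV.
apply: big1 => i _; rewrite expectZ; last first.
  by apply: moments; exact: gaussian_span_RV.
have := G_centered (t0 i); rewrite unlock => h.
by rewrite /expect /Rintegral h mulr0.
Qed.

Let law0 u : gaussian_span u -> measurable_fun setT u /\ exists s : R,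
  forall A : set R, measurable A -> P [set w | A (u w)] = gaussian_law 0 s A.
Proof.
move=> Su; have [mu [m [s lawu]]] := law Su; split => //; exists s.
by rewrite -(mean Su) /expect (gaussian_mean mu lawu).
Qed.

Let var u s : measurable_fun setT u ->
  (forall A : set R, measurable A -> P [set w | A (u w)] = gaussian_law 0 s A) ->
  forall k, E (u ^+ k.+2) = s ^+ 2 * k.+1%:R * E (u ^+ k).
Proof.
move=> mu lawu k; have := gaussian_moment_rec mu lawu k.
have uE j : \int[P]_w ((u w - 0) ^+ j) = E (u ^+ j).
  by apply: eq_Rintegral => w _; rewrite subr0 fctE.
by rewrite !uE.
Qed.

Lemma gaussian_span_space : gaussian_space P gaussian_span.
Proof.
split.
- exact: gaussian_spanD.
- exact: gaussian_spanZ.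
- exact: moments.
- exact: mean.
- move=> u k Su; have [mu [s lawu]] := law0 Su.
  rewrite !(var mu lawu) expr0 (_ : 1 = cst 1)// expect_cst !mulr1.
  by rewrite [k.+1%:R * _]mulrC.
Qed.

Lemma gaussian_span_small_ball u (a : R) : gaussian_span u ->
  (2^-1%:E < P [set w | (`|u w| <= a)%R])%E -> E (u ^+ 2) <= 16 * a ^+ 2.
Proof.
move=> Su h; have [mu [s lawu]] := law0 Su.
rewrite (var mu lawu 0) expr0 (_ : 1 = cst 1)// expect_cst !mulr1.
apply: (gaussian_small_ball lawu); under eq_set do rewrite subr0; exact: h.
Qed.

(** Self-similarity equates laws; this lemma turns it into a scaling relation
    for variances. *)
Lemma gaussian_span_eq_variance u v : gaussian_span u -> gaussian_span v ->
  (forall A : set R, measurable A -> P [set w | A (u w)] = P [set w | A (v w)]) ->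
  E (u ^+ 2) = E (v ^+ 2).
Proof.
move=> Su Sv uv; have [mu [s lawu]] := law0 Su; have [mv _] := law0 Sv.
have lawv A : measurable A -> P [set w | A (v w)] = gaussian_law 0 s A.
  by move=> mA; rewrite -uv// lawu.
by rewrite (var mu lawu 0) (var mv lawv 0) !expr0.
Qed.

End gaussian_span.

(** * Variances and covariances of increments *)

Lemma semidefinite_discriminant {R : realFieldType} (a b c : R) :
  (forall x y, 0 <= x ^+ 2 * a + 2 * x * y * b + y ^+ 2 * c) -> b ^+ 2 <= a * c.
Proof.
move=> key; have a0 : 0 <= a by have := key 1 0; lra.
have [a1|a1] := eqVneq a 0; last first.
  have a2 : 0 < a by rewrite lt_neqAle eq_sym a1.
  by rewrite -(ler_pM2l a2); have := key b (- a); lra.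
(* The test vector [(b, - a)] of the other case carries no information when
   [a = 0]; here the form is affine in [x] and takes negative values unless
   [b = 0]. *)
rewrite a1 mul0r leNgt; apply/negP => b2.
have b0 : b != 0 by apply: contraTneq b2 => ->; rewrite expr0n ltxx.
have := key (- (c + 1) / (2 * b)) 1; rewrite a1 mulr0 add0r.
rewrite (_ : 2 * _ * 1 * b = - (c + 1)); last by field.
by rewrite expr1n mul1r; lra.
Qed.

Section increments.
Context {d : measure_display} {Omega : measurableType d} {R : realType}
  (P : probability Omega R) (G : R -> {RV P >-> R}) (H : R).
Local Notation E := (expect P).
Hypotheses (G_gaussian : gaussian_process G) (G_centered : centered_process G).
Hypothesis G_self_similar : self_similar H G.
Local Notation X t := (MeasurableFun.sort (G t)).

Let gS := gaussian_span_space G_gaussian G_centered.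

Let span_incr s t : 0 <= s -> 0 <= t -> gaussian_span G (X t - X s).
Proof. by move=> s0 t0; apply: gaussian_spanB; exact: gaussian_span_RV. Qed.

Lemma sqincrE s t : sqincr G s t = E ((X t - X s) ^+ 2).
Proof.
by rewrite /sqincr unlock; congr fine; apply: eq_integral.
Qed.

Lemma sqincr_ge0 s t : 0 <= sqincr G s t.
Proof. by rewrite sqincrE; apply: expect_ge0 => w; rewrite fctE sqr_ge0. Qed.

Lemma expect_incr_mul (a b c e : R) : 0 <= a -> 0 <= b -> 0 <= c -> 0 <= e ->
  E ((X b - X a) * (X e - X c)) = 2^-1 *
    (sqincr G a e + sqincr G b c - sqincr G a c - sqincr G b e).
Proof.
move=> a0 b0 c0 e0; rewrite !sqincrE.
have m (u v : R) : 0 <= u -> 0 <= v -> all_moments P ((X v - X u) ^+ 2).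
  move=> u0 v0; apply: all_momentsX.
  by apply: gs_moments gS _ _; exact: span_incr.
have -> : (X b - X a) * (X e - X c) = cst 2^-1 *
    ((X e - X a) ^+ 2 + (X c - X b) ^+ 2 - (X c - X a) ^+ 2 - (X e - X b) ^+ 2).
  by apply/funext => w; rewrite !fctE; field.
rewrite expectZ ?expectB ?expectD //;
  by do ?[by apply: m | apply: all_momentsB | apply: all_momentsD].
Qed.

Lemma expect_incr_cauchy (a b c e : R) : 0 <= a -> 0 <= b -> 0 <= c -> 0 <= e ->
  E ((X b - X a) * (X e - X c)) ^+ 2 <= sqincr G a b * sqincr G c e.
Proof.
move=> a0 b0 c0 e0; rewrite !sqincrE.
set u := X b - X a; set v := X e - X c.
have mu : all_moments P u by apply: gs_moments gS _ _; exact: span_incr.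
have mv : all_moments P v by apply: gs_moments gS _ _; exact: span_incr.
have muv : all_moments P (u * v) by exact: all_momentsM.
have mu2 : all_moments P (u ^+ 2) by exact: all_momentsX.
have mv2 : all_moments P (v ^+ 2) by exact: all_momentsX.
have mc c' : all_moments P (cst c') by exact: all_moments_cst.
have key x y : 0 <= x ^+ 2 * E (u ^+ 2) + 2 * x * y * E (u * v) + y ^+ 2 * E (v ^+ 2).
  have : 0 <= E ((cst x * u + cst y * v) ^+ 2).
    by apply: expect_ge0 => w; rewrite fctE sqr_ge0.
  have -> : (cst x * u + cst y * v) ^+ 2 = cst (x ^+ 2) * u ^+ 2 +
      (cst (2 * x * y) * (u * v) + cst (y ^+ 2) * v ^+ 2).
    by apply/funext => w; rewrite !fctE; ring.
  rewrite !expectD ?expectZ ?addrA//; do ?[apply: all_momentsM => // | apply: all_momentsD => //].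
exact: semidefinite_discriminant key.
Qed.

Lemma sqincr_scale (a s t : R) : 0 < a -> 0 <= s -> 0 <= t ->
  sqincr G (a * s) (a * t) = a `^ (2 * H) * sqincr G s t.
Proof.
move=> a0 s0 t0; rewrite !sqincrE.
have aH : a `^ (2 * H) = (a `^ H) ^+ 2.
  by rewrite -powR_mulrn ?powR_ge0// -powRrM mulrC.
have mt : all_moments P (X t - X s) by apply: gs_moments gS _ _; exact: span_incr.
rewrite aH -expectZ; last exact: all_momentsX.
have -> : cst ((a `^ H) ^+ 2) * (X t - X s) ^+ 2 = (cst (a `^ H) * (X t - X s)) ^+ 2.
  by apply/funext => w; rewrite !fctE; ring.
apply: (gaussian_span_eq_variance G_gaussian G_centered).
- by apply: span_incr; rewrite mulr_ge0// ltW.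
- by apply: gaussian_spanZ; exact: span_incr.
move=> A mA; pose tt (i : 'I_2) := if i == ord0 then s else t.
pose B := [set b : 2.-tuple (measurableTypeR R) | A (tnth b ord_max - tnth b ord0)].
have mB : measurable B.
  rewrite -[B]setTI; apply: (_ : measurable_fun setT (fun b : 2.-tuple (measurableTypeR R) =>
      (tnth b ord_max : R) - tnth b ord0)) => //.
  by apply: measurable_funB; exact: measurable_tnth.
have := @G_self_similar a 2 tt a0 _ B mB; rewrite /B /tt.
have t02 i : 0 <= tt i by rewrite /tt; case: ifP.
move=> /(_ t02); under eq_set do rewrite /= !tnth_mktuple/=.
under [in RHS]eq_set do rewrite /= !tnth_mktuple/= -mulrBr.
by [].
Qed.

End increments.

(** * Increment bounds from regularity of the covariance and of the paths *)

(** The mean value theorem is applied in the second variable to [f b - f a],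
    and then in the first variable to the partial derivative at the point
    found. *)
Lemma double_increment_MVT {R : realType} (f : R -> R -> R) (a b c e : R) :
  a < b -> c < e ->
  (forall s t, a <= s <= b -> c <= t <= e ->
     derivable (fun u => f s u) t 1 /\
     derivable (fun u => pderiv2 f u t) s 1) ->
  exists s t, [/\ a <= s <= b, c <= t <= e &
    f b e - f a e - f b c + f a c =
    pderiv1 (pderiv2 f) s t * ((b - a) * (e - c))].
Proof.
move=> ab ce df.
have aab : a <= a <= b by rewrite lexx ltW.
have bab : a <= b <= b by rewrite lexx ltW.
have dt s t : a <= s <= b -> c <= t <= e ->
    is_derive t (1 : R) (f s) (pderiv2 f s t).
  move=> hs ht; have [h _] := df _ _ hs ht; split; first exact: h.
  by rewrite /pderiv2 derive1E.
have [t tce tE] : exists2 t, t \in `]c, e[%R &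
    (f b e - f a e) - (f b c - f a c) = (pderiv2 f b t - pderiv2 f a t) * (e - c).
  apply: (@MVT _ (f b - f a) (fun t => pderiv2 f b t - pderiv2 f a t)) => //.
    move=> x; rewrite in_itv/= => /andP[cx xe].
    have hx : c <= x <= e by rewrite !ltW.
    by apply: is_deriveB; exact: dt.
  apply: derivable_within_continuous => x; rewrite in_itv/= => hx.
  by apply: derivableB; [have := dt b x bab hx|have := dt a x aab hx]; case.
have hce : c <= t <= e by move: tce; rewrite in_itv/= => /andP[? ?]; rewrite !ltW.
(* The slice of the partial derivative gets a name of its own, so that the
   derivative in [u] is not confused with the one inside [pderiv2]. *)
have [h [hE h2E hd]] : exists h : R -> R, [/\ forall u, pderiv2 f u t = h u,
    forall u, pderiv1 (pderiv2 f) u t = derive1 h u &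
    forall u, a <= u <= b -> derivable h u 1].
  by exists (fun u => pderiv2 f u t); split => // u hu; have [] := df u t hu hce.
have [s sab sE] : exists2 s, s \in `]a, b[%R & h b - h a = derive1 h s * (b - a).
  apply: (@MVT _ h (derive1 h)) => //.
    move=> x; rewrite in_itv/= => /andP[ax xb].
    by split; [apply: hd; rewrite !ltW | rewrite derive1E].
  by apply: derivable_within_continuous => x; rewrite in_itv/= => /hd.
rewrite -!hE -h2E in sE.
exists s, t; split => //.
  by move: sab; rewrite in_itv/= => /andP[? ?]; rewrite !ltW.
by rewrite mulrA -sE -tE; ring.
Qed.

Section increment_bounds.
Context {d : measure_display} {Omega : measurableType d} {R : realType}
  (P : probability Omega R) (G : R -> {RV P >-> R}) (H : R).
Local Notation E := (expect P).
Hypothesis H_lt1 : H < 1.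
Hypotheses (G_gaussian : gaussian_process G) (G_centered : centered_process G).
Hypothesis G_self_similar : self_similar H G.
Hypotheses (GA1 : assumptionA1 H G) (GA2 : assumptionA2 H G).
Local Notation X t := (MeasurableFun.sort (G t)).

(** The points of the rectangle [[a, b] x [c, e]] are at distance at least
    [c - b] from the diagonal, and the exponent [2 H - 2] is negative, so the
    bound on the mixed derivative is worst at the corner [(b, c)]. *)
Lemma sqincr_double_increment : exists2 C : R, 0 <= C &
  forall a b c e, 0 < a -> a < b -> b < c -> c < e ->
  `|sqincr G b e - sqincr G a e - sqincr G b c + sqincr G a c| <=
  C * (c - b) `^ (2 * H - 2) * ((b - a) * (e - c)).
Proof.
have [reg [C CP]] := GA1.
exists `|C| => // a b c e a0 ab bc ce.
have df u v : a <= u <= b -> c <= v <= e ->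
    derivable (fun w => sqincr G u w) v 1 /\
    derivable (fun w => pderiv2 (sqincr G) w v) u 1.
  move=> /andP[au ub] /andP[cv ve].
  have od : offdiag (u, v).
    split => /=; first exact: lt_le_trans au.
      by rewrite (lt_le_trans a0)// (le_trans au)// (le_trans ub)// (le_trans (ltW bc)).
    by rewrite lt_eqF// (le_lt_trans ub)// (lt_le_trans bc).
  have [_ h2 h3 _ _] := reg _ od.
  split; [exact: h2|exact: h3].
have [s [t [/andP[as_ sb] /andP[ct te] ->]]] := double_increment_MVT ab ce df.
have s0 : 0 < s by exact: lt_le_trans as_.
have st : s < t by rewrite (le_lt_trans sb)// (lt_le_trans bc).
have t0 : 0 < t by exact: lt_trans st.
rewrite normrM [`|(b - a) * _|]ger0_norm; last by rewrite mulr_ge0 ?subr_ge0 ?ltW.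
apply: ler_wpM2r; first by rewrite mulr_ge0 ?subr_ge0 ?ltW.
have od : offdiag (s, t) by split => //=; rewrite lt_eqF.
apply: (le_trans (CP s t od)).
rewrite [`|t - s|]gtr0_norm ?subr_gt0//.
apply: (@le_trans _ _ (`|C| * (t - s) `^ (2 * H - 2))).
  by rewrite ler_wpM2r ?powR_ge0 ?ler_norm.
apply: ler_wpM2l => //.
have -> : 2 * H - 2 = - (2 - 2 * H) by ring.
rewrite !powRN lef_pV2 ?posrE ?powR_gt0 ?subr_gt0//.
apply: ge0_ler_powR; rewrite ?nnegrE ?subr_ge0.
- by have := H_lt1; lra.
- exact: ltW.
- exact: ltW.
- exact: lerB.
Qed.

(** A random Hoelder constant is bounded by some number with probability more
    than one half, and a Gaussian variable is controlled by such an event. *)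
Lemma sqincr_near1 (delta : R) : 0 < delta < H -> exists2 C : R, 0 <= C &
  forall j : nat, (0 < j)%N ->
    sqincr G (1 - j%:R^-1) 1 <= C * (j%:R `^ delta) ^- 2.
Proof.
move=> hd; have d0 : 0 < delta by case/andP: hd.
pose D j : Omega -> R := X 1 - X (1 - j.+1%:R^-1).
(* [B M] is the event that [M] serves as a Hoelder constant for the pairs
   [(1 - 1 / j, 1)]; these events increase to an almost sure one. *)
pose B M := \bigcap_j [set w | `|D j w| <= M%:R * (j.+1%:R `^ delta)^-1].
have j01 (j : nat) : 0 <= 1 - j.+1%:R^-1 :> R.
  by rewrite subr_ge0 invf_le1 ?ler1n// ltr0n.
have SD j : gaussian_span G (D j) by apply: gaussian_spanB; exact: gaussian_span_RV.
have mDj j : measurable_fun setT (D j).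
  apply: all_moments_measurable.
  exact: gs_moments (gaussian_span_space G_gaussian G_centered) _ (SD j).
have mset M j : measurable [set w | `|D j w| <= M%:R * (j.+1%:R `^ delta)^-1].
  rewrite -[Y in measurable Y]setTI.
  have -> : [set w | `|D j w| <= M%:R * (j.+1%:R `^ delta)^-1] =
     (fun w => `|D j w|) @^-1` `]-oo, M%:R * (j.+1%:R `^ delta)^-1].
    by apply/seteqP; split => w /=; rewrite in_itv.
  have mn : measurable_fun setT (fun w => `|D j w|).
    by apply: measurableT_comp => //; exact: mDj.
  by apply: mn => //; exact: measurable_itv.
have mB M : measurable (B M) by apply: bigcap_measurable => // j _.
have ndB : nondecreasing_seq B.
  move=> m n mn; apply/subsetPset => w Bw j _ /=.
  apply: (le_trans (Bw j I)); rewrite ler_wpM2r ?invr_ge0 ?powR_ge0//.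
  by rewrite ler_nat.
have PB : P (\bigcup_M B M) = 1%E.
  have [N [mN PN0 sub]] := GA2 hd.
  apply/eqP; rewrite eq_le probability_le1/=; last exact: bigcup_measurable.
  have -> : 1%E = P (~` N) by rewrite probability_setC// PN0 sube0.
  apply: le_measure; rewrite ?inE; [exact: measurableC|exact: bigcup_measurable|].
  move=> w Nw; have [C CP] : holder_on `[0, 1] delta (fun t => G t w).
    suff : forall S : R, 0 < S -> holder_on `[0, S] delta (fun t => G t w) by apply.
    by apply: contrapT => h; apply: Nw; exact: sub.
  have [M CM] : exists M : nat, C <= M%:R.
    by exists (Num.truncn `|C|).+1; rewrite (le_trans (ler_norm _))// ltW// truncnS_gt.
  exists M => // j _ /=; rewrite /D !fctE.
  have h1 : `[0, 1]%classic (1 - j.+1%:R^-1 : R).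
    by rewrite /= in_itv/= j01/= gerBl invr_ge0.
  have h2 : `[0, 1]%classic (1 : R) by rewrite /= in_itv/= ler01 lexx.
  apply: (le_trans (CP _ _ h1 h2)); rewrite subKr ger0_norm ?invr_ge0//.
  rewrite -powR_inv1 // -powRrM mulN1r powRN.
  by rewrite ler_wpM2r ?invr_ge0 ?powR_ge0.
have [M hM] : exists M, (2^-1%:E < P (B M))%E.
  apply: contrapT => h.
  have hle M : (P (B M) <= 2^-1%:E)%E by rewrite leNgt; apply/negP => ?; apply: h; exists M.
  have cv : (P (B n) @[n --> \oo] --> P (\bigcup_M B M))%E.
    exact: (nondecreasing_cvg_mu (mu := P) mB (bigcup_measurable (fun k _ => mB k)) ndB).
  rewrite PB in cv.
  have : (1 <= 2^-1%:E :> \bar R)%E.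
    rewrite -(cvg_lim _ cv)//.
    by apply: lime_le; [apply/cvg_ex; exists 1%E|exact: nearW].
  by rewrite lee_fin leNgt invf_lt1// ltr1n.
exists (16 * M%:R ^+ 2); first by rewrite mulr_ge0// sqr_ge0.
move=> [//|j] _; rewrite sqincrE.
apply: (le_trans (gaussian_span_small_ball G_gaussian G_centered (a := M%:R * (j.+1%:R `^ delta)^-1) (SD j) _)).
  apply: (lt_le_trans hM); apply: le_measure; rewrite ?inE//.
  by move=> w /(_ j I).
by rewrite exprMn exprVn mulrA.
Qed.

End increment_bounds.

(** * Partial sums of the harmonic series *)

Section quarter_root.
Context {R : realType}.

(** The fourth root dominates the partial sums of the harmonic series, and it
    keeps the estimates polynomial: consecutive values [y] and [x] satisfy
    [x ^+ 4 = y ^+ 4 + 1]. *)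
Definition quarter_root (k : nat) : R := k%:R `^ 4^-1.

Lemma quarter_root_ge0 k : 0 <= quarter_root k.
Proof. exact: powR_ge0. Qed.

Lemma quarter_rootX4 k : quarter_root k ^+ 4 = k%:R.
Proof.
by rewrite /quarter_root -powR_mulrn ?powR_ge0// -powRrM mulVf// powRr1.
Qed.

Lemma quarter_root_le k l : (k <= l)%N -> quarter_root k <= quarter_root l.
Proof.
by move=> kl; apply: ge0_ler_powR; rewrite ?nnegrE ?ler_nat.
Qed.

Lemma quarter_root_ge1 k : 1 <= quarter_root k.+1.
Proof.
have -> : 1 = quarter_root 1 by rewrite /quarter_root powR1.
exact: quarter_root_le.
Qed.

(** Factor [x ^+ 4 - y ^+ 4 = 1] by [x - y]. *)
Let step k (x := quarter_root k.+1) (y := quarter_root k) : 1 <= 4 * x ^+ 3 * (x - y).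
Proof.
have x4 : x ^+ 4 = y ^+ 4 + 1 by rewrite !quarter_rootX4 natr1.
have y0 : 0 <= y by exact: quarter_root_ge0.
have yx : y <= x by exact: quarter_root_le.
have x0 : 0 <= x by exact: quarter_root_ge0.
have e : (x ^+ 3 + x ^+ 2 * y + x * y ^+ 2 + y ^+ 3) * (x - y) = 1.
  by apply: (addrI (y ^+ 4)); rewrite -x4; ring.
rewrite -[leLHS]e; apply: ler_wpM2r; first by rewrite subr_ge0.
have h1 : x ^+ 2 * y <= x ^+ 3 by rewrite [x ^+ 3]exprSr ler_wpM2l// sqr_ge0.
have h2 : x * y ^+ 2 <= x ^+ 3 by rewrite [x ^+ 3]exprS ler_wpM2l// lerXn2r.
have h3 : y ^+ 3 <= x ^+ 3 by rewrite lerXn2r.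
lra.
Qed.

Lemma harmonic_sum_le (M : nat) :
  \sum_(0 <= k < M) (k.+1%:R^-1 : R) <= 4 * quarter_root M.
Proof.
elim: M => [|M ih]; first by rewrite big_geq// mulr_ge0 ?quarter_root_ge0.
rewrite big_nat_recr//= -[leRHS](subrK (4 * quarter_root M)) addrC lerD//.
have x1 := quarter_root_ge1 M; have st := step M.
rewrite -(quarter_rootX4 M.+1) -mulrBr; move: x1 st.
set x := quarter_root M.+1; set y := quarter_root M => x1 st.
have x0 : 0 < x by rewrite (lt_le_trans ltr01).
rewrite -[leLHS]mul1r ler_pdivrMr ?exprn_gt0//.
apply: (le_trans st); rewrite mulrAC ler_wpM2l//.
  rewrite mulr_ge0// subr_ge0; exact: quarter_root_le.
by rewrite ler_weXn2l.
Qed.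

(** The terms [k^(- 5 / 4)] are dominated by the increments of
    [- 4 k^(- 1 / 4)], which telescope. *)
Lemma quarter_root_series (M : nat) :
  \sum_(0 <= k < M) (quarter_root k.+1 ^- 5) <= 5.
Proof.
suff : \sum_(0 <= k < M.+1) (quarter_root k.+1 ^- 5) <= 5 - 4 * (quarter_root M.+1)^-1.
  rewrite big_nat_recr//= => h.
  have : 0 <= quarter_root M.+1 ^- 5 by rewrite invr_ge0 exprn_ge0 ?quarter_root_ge0.
  have : 0 <= (quarter_root M.+1)^-1 by rewrite invr_ge0 quarter_root_ge0.
  lra.
elim: M => [|M ih].
  rewrite big_nat1 /quarter_root powR1 expr1n invr1; lra.
rewrite big_nat_recr//=; apply: (le_trans (lerD ih (lexx _))).
have x1 := quarter_root_ge1 M.+1; have y1 := quarter_root_ge1 M; have st := step M.+1.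
have yx : quarter_root M.+1 <= quarter_root M.+2 by exact: quarter_root_le.
move: x1 y1 st yx.
set x := quarter_root M.+2; set y := quarter_root M.+1 => x1 y1 st yx.
have x0 : 0 < x by rewrite (lt_le_trans ltr01).
have y0 : 0 < y by rewrite (lt_le_trans ltr01).
have : x ^- 5 <= 4 * (y^-1 - x^-1).
  have -> : 4 * (y^-1 - x^-1) = (4 * (x - y) / y) * x ^+ 4 / x ^+ 5.
    by field; rewrite !gt_eqF.
  have x0' := ltW x0.
  rewrite -[leLHS]mul1r ler_wpM2r ?invr_ge0 ?exprn_ge0//.
  apply: (le_trans st).
  have -> : 4 * x ^+ 3 * (x - y) = 4 * (x - y) / x * x ^+ 4 by field; rewrite gt_eqF.
  rewrite ler_wpM2r ?exprn_ge0// ler_wpM2l ?lef_pV2 ?posrE//.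
  by rewrite mulr_ge0// subr_ge0.
lra.
Qed.

(** Every row of the kernel [1 / (1 + |i - j|)] is a piece of the harmonic
    series on either side of the diagonal. *)
Lemma toeplitz_harmonic_sum_le (M i : nat) : (i < M)%N ->
  \sum_(0 <= j < M) ((`|i - j|%N).+1%:R^-1 : R) <= 8 * quarter_root M.
Proof.
move=> iM; rewrite (@big_cat_nat _ _ _ i.+1)//=.
have -> : 8 * quarter_root M = 4 * quarter_root M + 4 * quarter_root M :> R by ring.
apply: lerD.
  rewrite big_nat_rev/= add0n.
  rewrite (eq_big_nat _ _ (F2 := fun k => k.+1%:R^-1)); last first.
    move=> k /andP[_ ki]; rewrite subSS distnEl ?leq_subr// subKn//.
  apply: (le_trans (harmonic_sum_le _)); rewrite ler_wpM2l//.
  exact: quarter_root_le.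
rewrite -{1}[i.+1]add0n big_addn.
apply: (@le_trans _ _ (\sum_(0 <= k < M - i.+1) (k.+1%:R^-1 : R))).
  apply: ler_sum_nat => k _; rewrite lef_pV2 ?posrE ?ltr0n// ler_nat ltnS.
  by rewrite distnEr; [rewrite addnS subSn ?addnK ?leq_addl|rewrite addnS leqW ?leq_addl].
apply: (le_trans (harmonic_sum_le _)); rewrite ler_wpM2l//.
by apply: quarter_root_le; rewrite leq_subr.
Qed.

End quarter_root.

(** * Sums of squared covariances of unit steps *)

Section covariance_sum.
Context {d : measure_display} {Omega : measurableType d} {R : realType}
  (P : probability Omega R) (G : R -> {RV P >-> R}) (H : R).
Local Notation E := (expect P).
Hypotheses (H_gt0 : 0 < H) (H_lt : H < 3 / 4).
Hypotheses (G_gaussian : gaussian_process G) (G_centered : centered_process G).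
Hypothesis G_self_similar : self_similar H G.
Hypotheses (GA1 : assumptionA1 H G) (GA2 : assumptionA2 H G).
Local Notation X t := (MeasurableFun.sort (G t)).

Definition increment (n i : nat) : Omega -> R :=
  X (i.+1%:R / n%:R) - X (i%:R / n%:R).

Definition increment_cov (i j : nat) : R := E (increment 1 i * increment 1 j).

Let time_ge0 (n i : nat) : 0 <= i%:R / n%:R :> R. Proof. by rewrite divr_ge0. Qed.

Lemma increment_cov_scale (n i j : nat) : (0 < n)%N ->
  E (increment n i * increment n j) = n%:R `^ (- (2 * H)) * increment_cov i j.
Proof.
move=> n0; rewrite /increment_cov !expect_incr_mul//.
have sc k l : sqincr G (k%:R / n%:R) (l%:R / n%:R) =
    n%:R `^ (- (2 * H)) * sqincr G (k%:R / 1) (l%:R / 1).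
  rewrite !divr1 [_ / n%:R]mulrC [l%:R / _]mulrC.
  rewrite (sqincr_scale G_gaussian G_centered G_self_similar) ?invr_gt0 ?ltr0n//.
  by rewrite -powR_inv1// -powRrM mulN1r.
by rewrite !sc; ring.
Qed.

Let step_variance (j : nat) := sqincr G (j%:R / 1) (j.+1%:R / 1).

Lemma increment_cov_diag (j : nat) : increment_cov j j = step_variance j.
Proof. by rewrite /increment_cov /step_variance sqincrE -expr2. Qed.

(** The step from [j] to [j + 1] is the step from [1 - 1 / (j + 1)] to [1]
    scaled by [j + 1], so its variance grows at most like
    [(j + 1)^(2 H - 2 delta)], for every [delta] below [H]. *)
Let step_variance_bound : exists2 C : R, 0 <= C &
  forall j, step_variance j <= C * j.+1%:R `^ 16^-1.
Proof.
have h0 := H_gt0; have h1 := H_lt.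
(* With this Hoelder exponent [delta], [2 H - 2 delta = H / 16 <= 1 / 16]. *)
have hd : 0 < H * (31 / 32) < H by apply/andP; split; lra.
have [C C0 CP] := sqincr_near1 G_gaussian G_centered GA2 hd.
exists C => // j; rewrite /step_variance !divr1.
have j0 : 0 < j.+1%:R :> R by rewrite ltr0n.
have -> : j%:R = j.+1%:R * (1 - j.+1%:R^-1) :> R.
  by rewrite mulrBr mulr1 divff ?gt_eqF// -natr1 addrK.
rewrite -[Y in sqincr G _ Y]mulr1 (sqincr_scale G_gaussian G_centered G_self_similar)//; last first.
  by rewrite subr_ge0 invf_le1// ler1n.
apply: (@le_trans _ _ (j.+1%:R `^ (2 * H) * (C * (j.+1%:R `^ (H * (31 / 32))) ^- 2))).
  by rewrite ler_wpM2l ?powR_ge0// CP.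
rewrite mulrCA ler_wpM2l// -powR_mulrn ?powR_ge0// -powRrM -powRN.
rewrite -powRD; last by apply/implyP => _; rewrite gt_eqF.
by apply: ler_powR; [rewrite ler1n|lra].
Qed.

Let cov_near : exists2 C : R, 0 <= C & forall M i j, (i < M)%N -> (j < M)%N ->
  increment_cov i j ^+ 2 <= C * M%:R `^ 8^-1.
Proof.
have [C C0 CP] := step_variance_bound.
exists (C * C); first exact: mulr_ge0.
have h M i : (i < M)%N -> step_variance i <= C * M%:R `^ 16^-1.
  move=> iM; apply: (le_trans (CP i)); rewrite ler_wpM2l//.
  by apply: ge0_ler_powR; rewrite ?nnegrE ?ler_nat.
move=> M i j iM jM.
apply: (le_trans (expect_incr_cauchy G_gaussian G_centered _ _ _ _)) => //.
have -> : C * C * M%:R `^ 8^-1 = (C * M%:R `^ 16^-1) * (C * M%:R `^ 16^-1).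
  rewrite mulrACA -powRD; last by apply/implyP => /eqP; lra.
  by congr (_ * _ `^ _); field.
by apply: ler_pM; [exact: sqincr_ge0|exact: sqincr_ge0|exact: h|exact: h].
Qed.

(** The covariance of two unit steps at distance [k] is [O(k^(2 H - 2))]. The
    condition [H < 3 / 4] is what makes its square [O(1 / k)]. The index is
    [i.+1] since the bound on the mixed derivative concerns positive times. *)
Let cov_far : exists2 C : R, 0 <= C & forall i k,
  increment_cov i.+1 (i.+1 + k.+2) ^+ 2 <= C * k.+1%:R^-1.
Proof.
have h1 := H_lt; have H1 : H < 1 by lra.
have [C C0 CP] := sqincr_double_increment H1 GA1.
exists ((2^-1 * C) ^+ 2); first exact: sqr_ge0.
move=> i k; rewrite /increment_cov expect_incr_mul//.
rewrite !divr1.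
set a : R := i.+1%:R; set b : R := i.+2%:R; set c : R := (i.+1 + k.+2)%:R.
set e : R := (i.+1 + k.+2).+1%:R.
have ba : b = a + 1 by rewrite /b /a -natr1.
have ec : e = c + 1 by rewrite /e /c -natr1.
have cb : c - b = k.+1%:R.
  rewrite /c /b -natrB; last by rewrite addnS ltnS leq_addr.
  by rewrite -[i.+2]addn1 subnDA addKn subn1.
have k0 : 0 < k.+1%:R :> R by rewrite ltr0n.
have := CP a b c e; rewrite cb.
have -> : b - a = 1 by rewrite ba addrC addKr.
have -> : e - c = 1 by rewrite ec addrC addKr.
rewrite !mulr1 => h; have {}h := h _ _ _ _.
have {}h : `|sqincr G b e - sqincr G a e - sqincr G b c + sqincr G a c| <=
    C * k.+1%:R `^ (2 * H - 2).
  by apply: h; rewrite ?ltr0n// ?ba ?ec ?ltrDl// -ba -subr_gt0 cb.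
rewrite !exprMn -[leRHS]mulrA; apply: ler_wpM2l; first exact: sqr_ge0.
have -> : (sqincr G a e + sqincr G b c - sqincr G a c - sqincr G b e) ^+ 2 =
  `|sqincr G b e - sqincr G a e - sqincr G b c + sqincr G a c| ^+ 2.
  by rewrite real_normK ?num_real//; ring.
apply: (@le_trans _ _ ((C * k.+1%:R `^ (2 * H - 2)) ^+ 2)).
  by rewrite lerXn2r ?nnegrE// mulr_ge0 ?powR_ge0.
rewrite exprMn; apply: ler_wpM2l; first exact: sqr_ge0.
rewrite -powR_mulrn ?powR_ge0// -powRrM -powR_inv1; last exact: ltW.
by apply: ler_powR; [rewrite ler1n|lra].
Qed.

Lemma increment_covC i j : increment_cov i j = increment_cov j i.
Proof. by rewrite /increment_cov mulrC. Qed.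

(** The estimate at a distance says nothing about the first step, which starts
    at time 0, nor about adjacent steps. There the variance bound is used, whose
    loss [M ^ (1 / 8)] is affordable. The indicators mark the row and the
    column of the first step. *)
Let cov_pointwise : exists2 C : R, 0 <= C & forall M i j, (i < M)%N -> (j < M)%N ->
  increment_cov i j ^+ 2 <= C * M%:R `^ 8^-1 *
    ((i == 0%N)%:R + (j == 0%N)%:R + (`|i - j|%N).+1%:R^-1).
Proof.
have [C1 C10 nearC] := cov_near; have [C2 C20 far] := cov_far.
exists (2 * C1 + 3 * C2); first lra.
have weak M : (0 < M)%N -> 1 <= M%:R `^ 8^-1 :> R.
  by move=> M0; rewrite -[leLHS](powRr0 M%:R) ler_powR// ler1n.
suff main M i j : (i <= j)%N -> (j < M)%N ->
  increment_cov i j ^+ 2 <= (2 * C1 + 3 * C2) * M%:R `^ 8^-1 *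
    ((i == 0%N)%:R + (j == 0%N)%:R + (`|i - j|%N).+1%:R^-1).
  move=> M i j iM jM; have [ij|/ltnW ji] := leqP i j; first exact: main.
  by rewrite increment_covC distnC [_%:R + _%:R]addrC; exact: main.
move=> ij jM; have iM : (i < M)%N by exact: leq_ltn_trans jM.
have z1 := weak M (leq_ltn_trans (leq0n _) jM).
have h := nearC M i j iM jM.
move: ij; set z := M%:R `^ _ in z1 h *.
have z0 : 0 <= z by lra.
case: i iM h => [|i] iM h ij.
  rewrite eqxx; apply: (le_trans h).
  have : 0 <= (j == 0%N)%:R + (`|0 - j|%N).+1%:R^-1 :> R by rewrite addr_ge0// invr_ge0.
  rewrite -[true%:R + _ + _]addrA; set p := (j == 0%N)%:R + _ => p0.
  rewrite mulrDr mulr1.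
  have : 0 <= (2 * C1 + 3 * C2) * z * p by rewrite !mulr_ge0// addr_ge0// mulr_ge0.
  have : 0 <= (C1 + 3 * C2) * z by rewrite mulr_ge0// addr_ge0// mulr_ge0.
  lra.
rewrite gtn_eqF// gtn_eqF ?(leq_ltn_trans _ ij)// !add0r.
have [k jE] : exists k, j = (i.+1 + k)%N by exists (j - i.+1)%N; rewrite subnKC.
rewrite jE in h *; rewrite distnEr ?leq_addr// addKn.
have Cz : 0 <= C1 * z by exact: mulr_ge0.
have Cz2 : 0 <= C2 * z by exact: mulr_ge0.
case: k jE h => [|[|k]] jE h.
- by apply: (le_trans h); rewrite invr1 mulr1; lra.
- apply: (le_trans h); rewrite -[leLHS](mulfK (_ : 2 != 0 :> R)) ?pnatr_eq0// ler_wpM2r ?invr_ge0//; lra.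
apply: (le_trans (far i k)); have k0 : 0 < k.+1%:R :> R by rewrite ltr0n.
rewrite ler_pdivlMr ?ltr0n// mulrAC ler_pdivrMr//.
rewrite -[k.+3%:R]natr1 -[k.+2%:R]natr1.
have kk : 1 <= k.+1%:R :> R by rewrite ler1n.
move: k0 kk Cz Cz2; set kr := k.+1%:R => k0 kk Cz Cz2.
have : C2 * kr <= C2 * z * kr by rewrite ler_wpM2r ?ler_peMr// ltW.
have : C2 <= C2 * kr by rewrite ler_peMr.
have : 0 <= C1 * z * kr by rewrite mulr_ge0// ltW.
lra.
Qed.

(** The [M^2] squares sum to [O(M^(1 + 1 / 4 + 1 / 8))]: the harmonic kernel
    contributes [M^(1 + 1 / 4)], and [M^(1 / 8)] comes from the variances. *)
Lemma increment_cov_sum : exists2 C : R, 0 <= C & forall M : nat,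
  (\sum_(0 <= i < M) \sum_(0 <= j < M) increment_cov i j ^+ 2) ^+ 2 <=
  C * M%:R ^+ 2 * quarter_root M ^+ 3.
Proof.
have [C C0 CP] := cov_pointwise.
exists (100 * C ^+ 2); first by rewrite mulr_ge0// sqr_ge0.
move=> M; have [->|M0] := posnP M.
  by rewrite big_geq// expr0n /= mulr0 mul0r.
pose z : R := M%:R `^ 8^-1; pose x := quarter_root M : R.
have z0 : 0 <= z by exact: powR_ge0.
have zx : z ^+ 2 = x.
  by rewrite /z /x /quarter_root -powR_mulrn ?powR_ge0// -powRrM; congr (_ `^ _); field.
have x1 : 1 <= x by rewrite /x -(prednK M0) quarter_root_ge1.
have sum_delta : \sum_(0 <= j < M) ((j == 0%N)%:R : R) = 1.
  rewrite -(prednK M0) big_nat_recl//= big1_seq ?addr0//.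
have -> : 100 * C ^+ 2 * M%:R ^+ 2 * quarter_root M ^+ 3 =
    (C * z * (10 * M%:R * x)) ^+ 2.
  by rewrite !exprMn zx -/x; ring.
have M1 : 1 <= M%:R :> R by rewrite ler1n.
rewrite lerXn2r ?nnegrE.
- rewrite //.
- by do 2 (apply: sumr_ge0 => ? _); exact: sqr_ge0.
- by rewrite !mulr_ge0//; lra.
apply: (@le_trans _ _ (\sum_(0 <= i < M) C * z * (M%:R * (i == 0%N)%:R + 1 + 8 * x))).
  apply: ler_sum_nat => i /andP[_ iM].
  apply: (@le_trans _ _ (\sum_(0 <= j < M) C * z *
     ((i == 0%N)%:R + (j == 0%N)%:R + (`|i - j|%N).+1%:R^-1))).
    by apply: ler_sum_nat => j /andP[_ jM]; exact: CP.
  rewrite -mulr_sumr; apply: ler_wpM2l; first exact: mulr_ge0.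
  rewrite !big_split/= sum_delta sumr_const_nat subn0 lerD//.
    by rewrite lerD2r mulr_natl.
  exact: toeplitz_harmonic_sum_le.
rewrite -mulr_sumr; apply: ler_wpM2l; first exact: mulr_ge0.
rewrite !big_split/= -mulr_sumr sum_delta !sumr_const_nat subn0 mulr1.
rewrite -[8 * x *+ M]mulr_natl.
have : M%:R <= M%:R * x by rewrite ler_peMr// ltW// (lt_le_trans _ M1).
lra.
Qed.

End covariance_sum.

(** * Quadratic variation of the driving process *)

Section almost_sure.
Context {d : measure_display} {Omega : measurableType d} {R : realType}
  (P : probability Omega R).
Local Notation E := (expect P).

(** The series of the [F k] has a finite expectation; hence it converges almost
    surely and its terms tend to 0. *)
Lemma ae_cvg0_of_summable_expect (F : nat -> Omega -> R) (C : R) :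
  (forall k, all_moments P (F k)) -> (forall k w, 0 <= F k w) ->
  (forall n, \sum_(0 <= k < n) E (F k) <= C) ->
  {ae P, forall w, F n w @[n --> \oo] --> (0 : R)}.
Proof.
move=> mF F0 FC.
pose S w := (\sum_(0 <= k <oo) (F k w)%:E)%E.
have mFk k : measurable_fun setT (fun w => (F k w)%:E).
  by apply/measurable_EFinP; exact: all_moments_measurable.
have S0 w : (0 <= S w)%E by apply: nneseries_ge0 => k _ _; rewrite lee_fin.
have EF k : (\int[P]_w (F k w)%:E)%E = (E (F k))%:E.
  by rewrite /expect /Rintegral fineK//; apply: integrable_fin_num => //; exact: (mF k 1%N).
have SE : (\int[P]_w S w < +oo)%E.
  rewrite /S integral_nneseries//; last by move=> k w _; rewrite lee_fin.
  apply: (@le_lt_trans _ _ C%:E); last exact: ltry.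
  apply: lime_le.
    apply: is_cvg_ereal_nneg_natsum => k _.
    by apply: integral_ge0 => w _; rewrite lee_fin.
  apply: nearW => n; under eq_bigr do rewrite EF.
  by rewrite sumEFin lee_fin.
have iS : P.-integrable setT S.
  apply/integrableP; split.
    apply: ge0_emeasurable_sum => //.
      by move=> k w _ _; rewrite lee_fin.
  by under eq_integral do rewrite gee0_abs//.
have := integrable_ae measurableT iS; apply: filterS => w /(_ I) Sw.
apply: cvg_series_cvg_0; apply: nondecreasing_is_cvgn.
  apply/nondecreasing_seqP => n; rewrite /series/= big_nat_recr//= lerDl.
  exact: F0.
exists (fine (S w)) => _ [n _ <-].
rewrite -lee_fin fineK// /series/= -sumEFin.
by apply: nneseries_lim_ge => k _ _; rewrite lee_fin.
Qed.

End almost_sure.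

Section quadratic_variation.
Context {d : measure_display} {Omega : measurableType d} {R : realType}
  (P : probability Omega R) (G : R -> {RV P >-> R}) (H : R).
Local Notation E := (expect P).
Hypotheses (H_gt0 : 0 < H) (H_lt : H < 3 / 4).
Hypotheses (G_gaussian : gaussian_process G) (G_centered : centered_process G).
Hypothesis G_self_similar : self_similar H G.
Hypotheses (GA1 : assumptionA1 H G) (GA2 : assumptionA2 H G).
Hypothesis GA3 : assumptionA3 H G.
Local Notation incr := (increment G).
Local Notation icov := (increment_cov G).

Let normalized (n : nat) (M : nat) (i : 'I_M) : Omega -> R :=
  cst (n%:R `^ H) * incr n i.

Let span_incr n i : gaussian_span G (incr n i).
Proof. by apply: gaussian_spanB; apply: gaussian_span_RV; rewrite divr_ge0. Qed.

Let span_normalized n M (i : 'I_M) : gaussian_span G (normalized n i).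
Proof. exact: gaussian_spanZ. Qed.

Let gS := gaussian_span_space G_gaussian G_centered.

Let normalized_cov n M (i j : 'I_M) : (0 < n)%N ->
  E (normalized n i * normalized n j) = icov i j.
Proof.
move=> n0; have n0R : 0 < n%:R :> R by rewrite ltr0n.
have -> : normalized n i * normalized n j =
    cst (n%:R `^ (2 * H)) * (incr n i * incr n j).
  have -> : n%:R `^ (2 * H) = n%:R `^ H * n%:R `^ H.
    rewrite -powRD; last by apply/implyP => _; rewrite gt_eqF.
    by congr (_ `^ _); ring.
  by apply/funext => w; rewrite /normalized !fctE; ring.
rewrite expectZ; last first.
  by apply: all_momentsM; apply: (gs_moments gS); exact: span_incr.
rewrite (increment_cov_scale G_gaussian G_centered G_self_similar)//.
by rewrite mulrA -powRD ?subrr ?powRr0 ?mul1r//; apply/implyP => _; rewrite gt_eqF.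
Qed.

Let centered_QV (n M : nat) : Omega -> R :=
  cst n%:R^-1 * centered_square_sum P (@normalized n M).

Let centered_QV_moment4 : exists2 C : R, 0 <= C & forall n M : nat, (0 < n)%N ->
  E (centered_QV n M ^+ 4) <= C * M%:R ^+ 2 * quarter_root M ^+ 3 / n%:R ^+ 4.
Proof.
have [C C0 CP] := increment_cov_sum H_gt0 H_lt G_gaussian G_centered G_self_similar GA1 GA2.
exists (60 * C); first exact: mulr_ge0.
move=> n M n0; set Q := centered_square_sum P (@normalized n M).
have -> : centered_QV n M ^+ 4 = cst (n%:R^-1 ^+ 4) * Q ^+ 4.
  by apply/funext => w; rewrite /centered_QV !fctE exprMn.
have mQ : all_moments P Q.
  apply: all_moments_sum => i _.
  have mi : all_moments P (normalized n i) by apply: (gs_moments gS).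
  by apply: all_momentsD; apply: all_momentsM => //; exact: all_moments_cst.
rewrite expectZ; last exact: all_momentsX.
rewrite exprVn mulrC ler_wpM2r ?invr_ge0 ?exprn_ge0//.
apply: (le_trans (centered_square_sum_moment4 gS (@span_normalized n M))).
have -> : 60 * C * M%:R ^+ 2 * quarter_root M ^+ 3 =
  60 * (C * M%:R ^+ 2 * quarter_root M ^+ 3) by ring.
apply: ler_wpM2l => //; apply: le_trans (CP M); rewrite big_mkord.
rewrite le_eqVlt; apply/orP; left; apply/eqP; congr (_ ^+ 2); apply: eq_bigr => i _; rewrite big_mkord.
by apply: eq_bigr => j _; rewrite normalized_cov.
Qed.

(** With [M = O(n)] terms the fourth moment is [O(n^(2 + 3 / 4 - 4))], that is
    [O(n^(- 5 / 4))], and this is summable. The second moment alone would not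
    suffice. *)
Let centered_QV_cvg0 (t : R) : 0 <= t ->
  {ae P, forall w, centered_QV n.+1 (Num.truncn (n.+1%:R * t)) w @[n --> \oo] --> (0 : R)}.
Proof.
move=> t0; have [C C0 CP] := centered_QV_moment4.
pose K := (Num.truncn t).+1.
have tK : t <= K%:R by rewrite ltW// truncnS_gt.
pose M n := Num.truncn (n.+1%:R * t).
pose D := C * K%:R ^+ 2 * quarter_root K ^+ 3.
have D0 : 0 <= D by rewrite !mulr_ge0 ?exprn_ge0 ?quarter_root_ge0.
have mom n : all_moments P (centered_QV n.+1 (M n)).
  apply: all_momentsM; first exact: all_moments_cst.
  apply: all_moments_sum => i _.
  have mi : all_moments P (normalized n.+1 i) by apply: (gs_moments gS).
  by apply: all_momentsD; apply: all_momentsM => //; exact: all_moments_cst.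
have bound n : E (centered_QV n.+1 (M n) ^+ 4) <= D * quarter_root n.+1 ^- 5.
  apply: (le_trans (CP _ _ (ltn0Sn n))).
  have MK : (M n <= K * n.+1)%N.
    have : (M n)%:R <= (K * n.+1)%:R :> R.
      rewrite (@le_trans _ _ (n.+1%:R * t))//.
        by rewrite truncn_le mulr_ge0.
      by rewrite natrM mulrC ler_wpM2r.
    by rewrite ler_nat.
  have qn := quarter_root_ge1 (R := R) n.
  have qM : quarter_root (M n) <= quarter_root K * quarter_root n.+1 :> R.
    rewrite (le_trans (quarter_root_le MK))// /quarter_root natrM powRM//.
  have q0 : 0 < quarter_root n.+1 :> R by rewrite (lt_le_trans ltr01).
  have -> : D * quarter_root n.+1 ^- 5 = C * (K%:R * n.+1%:R) ^+ 2 *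
      (quarter_root K * quarter_root n.+1) ^+ 3 / n.+1%:R ^+ 4.
    rewrite -(quarter_rootX4 n.+1) /D; field.
    by rewrite gt_eqF.
  apply: ler_wpM2r; first by rewrite invr_ge0 exprn_ge0.
  apply: ler_pM; rewrite ?mulr_ge0 ?exprn_ge0 ?quarter_root_ge0//.
    rewrite ler_wpM2l// lerXn2r ?nnegrE ?mulr_ge0// -natrM ler_nat//.
  by rewrite lerXn2r ?nnegrE ?mulr_ge0 ?quarter_root_ge0.
have := @ae_cvg0_of_summable_expect _ _ _ P (fun n => centered_QV n.+1 (M n) ^+ 4) (D * 5).
have h1 k : all_moments P (centered_QV k.+1 (M k) ^+ 4) by exact: all_momentsX.
have h2 k w : 0 <= (centered_QV k.+1 (M k) ^+ 4) w.
  by rewrite fctE -[4%N]/(2 * 2)%N exprM sqr_ge0.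
move=> /(_ h1 h2) h; have {}h := h _.
have : {ae P, forall w, (centered_QV n.+1 (M n) ^+ 4) w @[n --> \oo] --> (0 : R)}.
  apply: h => n; apply: (@le_trans _ _ (\sum_(0 <= k < n) D * quarter_root k.+1 ^- 5)).
    by apply: ler_sum => k _; exact: bound.
  by rewrite -mulr_sumr ler_wpM2l// quarter_root_series.
apply: filterS => w; move=> /cvgr0Pnorm_lt cv4; apply/cvgr0Pnorm_lt => e e0.
have e40 : 0 < e ^+ 4 by rewrite exprn_gt0.
apply: filterS (cv4 _ e40) => n; rewrite fctE normrX.
by rewrite ltr_pXn2r// nnegrE ltW.
Qed.

Let mean_QV (M : nat) := \sum_(0 <= i < M) icov i i.

(** This is [assumptionA3] on the interval [(0, 1]], rescaled to unit steps by
    self-similarity. *)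
Let cesaro_mean : mean_QV m / m%:R @[m --> \oo] --> (1 : R).
Proof.
have := GA3 (ltnSn 0) (ltnSn 0); rewrite invr1; apply: cvg_trans.
apply: near_eq_cvg; near=> m.
have m0 : (0 < m)%N by near: m; exact: nbhs_infty_gt.
have m0R : 0 < m%:R :> R by rewrite ltr0n.
have blockE : block (R := R) m 1 1 = [set` index_iota 1 m.+1].
  apply/seteqP; split => j; rewrite /block /= subrr !divr1 mem_index_iota.
    move=> [j0 j1]; apply/andP; split.
      by rewrite lt0n; apply: contraTneq j0 => ->; rewrite mul0r ltxx.
    by rewrite ltnS -(ler_nat R) -[leRHS]mul1r -ler_pdivrMr.
  move=> /andP[j0 jm]; split; first by rewrite divr_gt0 ?ltr0n.
  by rewrite ler_pdivrMr// mul1r ler_nat.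
rewrite blockE -fsbig_seq ?iota_uniq// big_add1/= /mean_QV mulr_suml mulr_sumr.
apply: eq_bigr => i _; rewrite (increment_cov_diag G).
have e : i.+1%:R - 1 = i%:R :> R by rewrite -natr1 addrK.
rewrite e !divr1 [i%:R / _]mulrC [i.+1%:R / _]mulrC.
rewrite (sqincr_scale G_gaussian G_centered G_self_similar) ?invr_gt0//.
rewrite mulrA [RHS]mulrC; congr (_ * _).
rewrite -powR_inv1 ?(ltW m0R)// -powRrM -powRD; last by apply/implyP => _; rewrite gt_eqF.
by congr (_ `^ _); ring.
Unshelve. all: by end_near. Qed.

(** The mean over the first [M] steps, with [M] close to [n t], is [M / n] times
    the Cesaro mean over [M] steps, and [M / n] tends to [t]. *)
Let mean_QV_cvg (t : R) : 0 <= t ->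
  mean_QV (Num.truncn (n.+1%:R * t)) / n.+1%:R @[n --> \oo] --> t.
Proof.
rewrite le_eqVlt => /predU1P[<-|t0].
  under eq_fun do rewrite mulr0 truncn0 /mean_QV big_geq// mul0r.
  exact: cvg_cst.
pose M n := Num.truncn (n.+1%:R * t).
have nt n : 0 <= n.+1%:R * t by rewrite mulr_ge0// ltW.
have My : M n @[n --> \oo] --> \oo.
  apply/cvgnyPge => A; near=> n; rewrite truncn_ge_nat// -ler_pdivrMr//.
  apply: (@le_trans _ _ n%:R); last by rewrite ler_nat.
  by near: n; exact: nbhs_infty_ger.
have cM : (M n)%:R / n.+1%:R @[n --> \oo] --> t.
  apply: (@squeeze_cvgr _ _ _ _ (fun n => t - n.+1%:R^-1) (fun=> t)).
  - near=> n; have /andP[h1 h2] := truncn_itv (nt n).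
    have n0 : 0 < n.+1%:R :> R by rewrite ltr0n.
    rewrite ler_pdivrMr// ler_pdivlMr// [t * _]mulrC h1 andbT.
    rewrite mulrBl mulVf ?gt_eqF// [t * _]mulrC lerBlDr natr1; exact: ltW.
  - rewrite -[t in _ --> t]subr0; apply: cvgB; first exact: cvg_cst.
    exact: cvg_harmonic.
  - exact: cvg_cst.
have cc : mean_QV (M n) / (M n)%:R @[n --> \oo] --> (1 : R).
  exact: (cvg_comp M (fun m => mean_QV m / m%:R) My cesaro_mean).
have : mean_QV (M n) / (M n)%:R * ((M n)%:R / n.+1%:R) @[n --> \oo] --> 1 * t.
  exact: cvgM cc cM.
rewrite mul1r; apply: cvg_trans; apply: near_eq_cvg; near=> n => /=.
rewrite -/(M n); have [->|Mn] := posnP (M n).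
  by rewrite /mean_QV big_geq// !mul0r.
by rewrite mulrA divfK// pnatr_eq0 -lt0n.
Unshelve. all: by end_near. Qed.

Lemma QV_fixed_time (t : R) : 0 <= t ->
  {ae P, forall w, QV H (fun s => G s w) n t @[n --> \oo] --> t}.
Proof.
move=> t0; apply: filterS (centered_QV_cvg0 t0) => w cv.
rewrite -(cvg_shiftS (fun n => QV H (fun s => G s w) n t)).
have : centered_QV n.+1 (Num.truncn (n.+1%:R * t)) w +
    mean_QV (Num.truncn (n.+1%:R * t)) / n.+1%:R @[n --> \oo] --> 0 + t.
  exact: cvgD cv (mean_QV_cvg t0).
rewrite add0r; apply: cvg_trans; apply: near_eq_cvg; near=> n.
have n0 : 0 < n.+1%:R :> R by rewrite ltr0n.
rewrite /= /QV; set M := Num.truncn _; rewrite big_add1/= /centered_QV.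
rewrite -[LHS]/(n.+1%:R^-1 * centered_square_sum P (@normalized n.+1 M) w + mean_QV M / n.+1%:R).
rewrite mulrC -mulrDl /centered_square_sum fct_sumE /mean_QV !big_mkord -big_split/=.
rewrite mulr_suml mulr_sumr; apply: eq_bigr => i _.
rewrite !fctE normalized_cov// mulr1 subrK real_normK ?num_real//.
have -> : i.+1%:R - 1 = i%:R :> R by rewrite -natr1 addrK.
rewrite /normalized /increment !fctE.
rewrite (_ : 2 * H - 1 = H + H - 1); last by ring.
rewrite powRB; last by apply/implyP => _; rewrite gt_eqF.
rewrite powRD; last by apply/implyP => _; rewrite gt_eqF.
by rewrite powRr1 ?ltW//; ring.
Unshelve. all: by end_near. Qed.

End quadratic_variation.

(** * Young's estimate by bisection *)

Section young.
Context {R : realType} (f g : R -> R).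

Fixpoint left_sum (a : R) (s : seq R) : R :=
  if s is x :: s' then f a * (g x - g a) + left_sum x s' else 0.

Lemma left_sum_cat a s1 s2 :
  left_sum a (s1 ++ s2) = left_sum a s1 + left_sum (last a s1) s2.
Proof. by elim: s1 a => [|x s1 ih] a /=; rewrite ?add0r// ih addrA. Qed.

Lemma RS_sum_left a b s : RS_sum f g a b s (nth b (a :: s)) = left_sum a s.
Proof.
rewrite /RS_sum; elim: s a => [|x s ih] a; first by rewrite big_geq.
by rewrite /= big_nat_recl//= -ih.
Qed.

Fixpoint bisection (k : nat) (a b : R) : seq R :=
  if k is k'.+1 then bisection k' a ((a + b) / 2) ++ bisection k' ((a + b) / 2) b
  else [:: b].

Lemma last_bisection k a b x : last x (bisection k a b) = b.
Proof.
elim: k a b x => [//|k ih] a b x /=; by rewrite last_cat ih.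
Qed.

Definition fine_step (del : R) : rel R := fun x y => (x < y) && (y - x < del).

Lemma path_bisection del k a b : a < b -> b - a < del * 2 ^+ k ->
  path (fine_step del) a (bisection k a b).
Proof.
elim: k a b => [|k ih] a b ab; first by rewrite mulr1 /= /fine_step ab => ->.
rewrite exprS => bad /=; rewrite cat_path last_bisection.
by apply/andP; split; apply: ih; lra.
Qed.

(** Young's estimate. Halving an interval creates two errors for half of the
    length, each of them smaller by the factor [2^(- ga)], and one new error
    [C * (b - a) `^ ga]. The constant [K] of the conclusion is the fixed point
    of [K = 2 `^ (1 - ga) * K + C]. *)
Lemma left_sum_bisection (ga C T : R) : 1 < ga -> 0 <= C ->
  (forall a b c, 0 <= a -> a <= b -> b <= c -> c <= T ->
     `|(f b - f a) * (g c - g b)| <= C * (c - a) `^ ga) ->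
  forall k a b, 0 <= a -> a <= b -> b <= T ->
  `|left_sum a (bisection k a b) - f a * (g b - g a)| <=
    C / (1 - 2 `^ (1 - ga)) * (b - a) `^ ga.
Proof.
move=> bd1 C0 fg; set r := 2 `^ (1 - ga).
have r1 : r < 1.
  have ln2 : 0 < ln 2 :> R by apply: ln_gt0; rewrite ltr1n.
  by rewrite /r /powR pnatr_eq0/= -[ltRHS]expR0 ltr_expR pmulr_llt0// subr_lt0.
have r0 : 0 <= r by exact: powR_ge0.
set K := C / (1 - r).
have KE : K = r * K + C.
  by rewrite /K; field; rewrite subr_eq0 gt_eqF.
have K0 : 0 <= K by rewrite divr_ge0// subr_ge0 ltW.
elim=> [|k ih] a b a0 ab bT.
  by rewrite /= addr0 subrr normr0 mulr_ge0// powR_ge0.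
rewrite /= left_sum_cat last_bisection; set m := (a + b) / 2.
have am : a <= m by rewrite /m; lra.
have mb : m <= b by rewrite /m; lra.
have half (x y : R) : y - x = (b - a) / 2 -> (y - x) `^ ga * 2 = r * (b - a) `^ ga.
  move=> ->; rewrite powRM ?subr_ge0 ?invr_ge0// -(powR_inv1 (_ : 0 <= 2))//.
  rewrite -powRrM mulN1r /r powRD; last by apply/implyP => _; rewrite pnatr_eq0.
  by rewrite powRr1//; ring.
have h1 := ih a m a0 am (le_trans mb bT).
have h2 := ih m b (le_trans a0 am) mb bT.
have h3 := fg a m b a0 am mb bT.
set s1 := left_sum a _ in h1 *; set s2 := left_sum m _ in h2 *.
have -> : s1 + s2 - f a * (g b - g a) = (s1 - f a * (g m - g a)) +
   (s2 - f m * (g b - g m)) + (f m - f a) * (g b - g m) by ring.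
apply: (le_trans (ler_normD _ _)); rewrite KE [leRHS]mulrDl; apply: lerD h3.
apply: (le_trans (ler_normD _ _)); apply: (le_trans (lerD h1 h2)).
have e1 : (m - a) `^ ga * 2 = r * (b - a) `^ ga by apply: half; rewrite /m; field.
have -> : b - m = m - a by rewrite /m; field.
have -> : r * K * (b - a) `^ ga = K * (r * (b - a) `^ ga) by ring.
by rewrite -e1 mulrA [K * _ * 2]mulr_natr mulr2n.
Qed.

(** Both integrals are approximated along one partition of [[0, a]], which is
    continued by a bisection of [[a, b]] for the second one. The contribution of
    [[0, a]] cancels. *)
Lemma RS_integral_increment a b Ia Ib (c : R) (S : R) : 0 <= a -> a < b ->
  is_RS_integral f g 0 a Ia -> is_RS_integral f g 0 b Ib ->
  (forall k, `|left_sum a (bisection k a b) - S| <= c) ->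
  `|Ib - Ia - S| <= c.
Proof.
move=> a0 ab hIa hIb hS; apply/ler_addgt0Pr => e e0.
have e20 : 0 < e / 2 by rewrite divr_gt0.
have [da da0 ha] := hIa _ e20; have [db db0 hb] := hIb _ e20.
pose del := Num.min da db.
have del0 : 0 < del by rewrite lt_min da0.
have [k bk] : exists k, b < del * 2 ^+ k.
  exists (Num.truncn (b / del)).+1.
  rewrite mulrC -ltr_pdivrMr// (lt_trans (truncnS_gt _))//.
  by rewrite -natrX ltr_nat ltn_expl.
have part c' s : 0 <= c' -> path (fine_step del) 0 s -> last 0 s = c' ->
    itv_partition 0 c' s /\ (forall i, (i < size s)%N ->
       nth c' (0 :: s) i.+1 - nth c' (0 :: s) i < del /\
       nth c' (0 :: s) i <= nth c' (0 :: s) i <= nth c' (0 :: s) i.+1).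
  move=> c'0 ps ls; split.
    split; last by rewrite ls.
    by apply: sub_path ps => x y /andP[].
  move=> i si; have /(pathP c')/(_ i si)/andP[h1 h2] := ps.
  by rewrite lexx/=; split => //; exact: ltW.
(* The only partition of [[0, 0]] is the empty sequence. *)
pose s0 := if a == 0 then [::] else bisection k 0 a.
have ls0 : last 0 s0 = a.
  by rewrite /s0; have [->|_] := eqVneq a 0; rewrite ?last_bisection.
have ps0 : path (fine_step del) 0 s0.
  rewrite /s0; have [//|an0] := eqVneq a 0.
  by apply: path_bisection; [rewrite lt_neqAle eq_sym an0|rewrite subr0 (lt_trans ab)].
pose s1 := bisection k a b.
have ps1 : path (fine_step del) 0 (s0 ++ s1).
  rewrite cat_path ps0 ls0; apply: path_bisection => //.
  by rewrite (le_lt_trans _ bk)// gerBl.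
have ls1 : last 0 (s0 ++ s1) = b by rewrite last_cat last_bisection.
have [pa ma] := part a s0 a0 ps0 ls0.
have [pb mb] := part b _ (le_trans a0 (ltW ab)) ps1 ls1.
have {}ha : `|left_sum 0 s0 - Ia| < e / 2.
  rewrite -(RS_sum_left 0 a); apply: ha => // i si.
  have [h1 h2] := ma i si; split => //.
  by rewrite (lt_le_trans h1)// ge_min lexx.
have {}hb : `|left_sum 0 s0 + left_sum a s1 - Ib| < e / 2.
  rewrite -[in left_sum a s1]ls0 -left_sum_cat -(RS_sum_left 0 b); apply: hb => // i si.
  have [h1 h2] := mb i si; split => //.
  by rewrite (lt_le_trans h1)// ge_min lexx orbT.
have -> : Ib - Ia - S = (left_sum a s1 - S) + ((left_sum 0 s0 - Ia) -
   (left_sum 0 s0 + left_sum a s1 - Ib)) by ring.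
apply: (le_trans (ler_normD _ _)); apply: lerD; first exact: hS.
apply: (le_trans (ler_normB _ _)); lra.
Qed.

End young.

(** * Increments of the solution *)

Section solution_increment.
Context {R : realType} (T : R) (T_gt0 : 0 < T).
Local Notation mu := (@lebesgue_measure R).

Lemma continuous_within_bounded (h : R -> R) : {within `[0, T], continuous h} ->
  exists2 M : R, 0 <= M & forall s, 0 <= s <= T -> `|h s| <= M.
Proof.
move=> ch; have cn : {within `[0, T], continuous (fun s => `|h s|)}.
  by move=> s; apply: continuous_comp; [exact: ch|exact: norm_continuous].
have [c cT cM] := EVT_max (ltW T_gt0) cn.
by exists `|h c| => // s sT; apply: cM; rewrite in_itv.
Qed.

Lemma Rintegral_increment (h : R -> R) (a b : R) :
  mu.-integrable `[0, T] (EFin \o h) -> 0 <= a -> a <= b -> b <= T ->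
  \int[mu]_(s in `[0, b]) h s - \int[mu]_(s in `[0, a]) h s =
  \int[mu]_(s in `]a, b]) h s.
Proof.
move=> ih a0 ab bT; apply: Rintegral_itvB; rewrite ?bnd_simp//.
by apply: integrableS ih => // s /=; rewrite !in_itv/= => /andP[-> sb]; exact: le_trans bT.
Qed.

Lemma Rintegral_itvoc_dist (h : R -> R) (a b c e : R) :
  mu.-integrable `[0, T] (EFin \o h) -> 0 <= a -> a <= b -> b <= T ->
  (forall s, a <= s <= b -> `|h s - c| <= e) ->
  `|\int[mu]_(s in `]a, b]) h s - c * (b - a)| <= e * (b - a).
Proof.
move=> ih a0 ab bT hc.
have sub : `]a, b]%classic `<=` `[0, T]%classic.
  by move=> s /=; rewrite !in_itv/= => /andP[sa sb]; rewrite (le_trans a0 (ltW sa)) (le_trans sb).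
have ihab : mu.-integrable `]a, b] (EFin \o h) by apply: integrableS ih.
have ic k : mu.-integrable `]a, b] (EFin \o cst k).
  apply: (@integrableS _ _ _ mu `[0, T]%classic) => //.
  apply: continuous_compact_integrable; first exact: segment_compact.
  by move=> s; exact: cst_continuous.
have len : fine (mu `]a, b]%classic) = b - a.
  rewrite /= lebesgue_measure_itv/= lte_fin; move: ab; rewrite le_eqVlt.
  by case/predU1P => [->|->//]; rewrite ltxx subrr.
rewrite -len -!Rintegral_cst// -RintegralB//; last exact: (ic c).
apply: (le_trans (le_normr_Rintegral _ _)) => //.
  exact: (integrableB _ ihab (ic c)).
apply: le_Rintegral => //.
- exact: (integrable_norm (integrableB _ ihab (ic c))).
- exact: ic.
- by move=> s /=; rewrite in_itv/= => /andP[sa sb]; apply: hc; rewrite (ltW sa).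
Qed.

Context (sigma g x : R -> R) (beta delta theta x0 : R).
Hypotheses (beta_gt0 : 0 < beta) (delta_gt0 : 0 < delta) (bd : 1 < beta + delta).
Hypothesis sigma_holder : holder_on `[0, T] beta sigma.
Hypothesis g_holder : holder_on `[0, T] delta g.
Hypothesis x_sol : solves_OU theta sigma x0 T g x.

(** Young's estimate bounds the error of freezing [sigma] in the stochastic
    integral by a multiple of [(b - a) `^ (beta + delta)], whose exponent exceeds
    1, and the drift is of order [b - a]. *)
Lemma solution_increment : exists2 C : R, 0 <= C & forall a b,
  0 <= a -> a < b -> b <= T ->
  `|x b - x a - sigma a * (g b - g a)| <= C * (b - a).
Proof.
have [xc xE] := x_sol.
have [M M0 MP] := continuous_within_bounded xc.
have ix : mu.-integrable `[0, T] (EFin \o x).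
  by apply: continuous_compact_integrable => //; exact: segment_compact.
have [Cs hs] := sigma_holder; have [Cg hg] := g_holder.
pose C1 := `|Cs| * `|Cg|; pose ga := beta + delta.
have ga1 : 1 < ga by [].
have C10 : 0 <= C1 by exact: mulr_ge0.
have prod a b c : 0 <= a -> a <= b -> b <= c -> c <= T ->
    `|(sigma b - sigma a) * (g c - g b)| <= C1 * (c - a) `^ ga.
  move=> a0 ab bc cT.
  have inT s : a <= s -> s <= c -> `[0, T]%classic s.
    by move=> as_ sc; rewrite /= in_itv/= (le_trans a0 as_) (le_trans sc).
  have ac := le_trans ab bc.
  have holder (h : R -> R) C p u v : 0 < p ->
      (forall s t, `[0, T]%classic s -> `[0, T]%classic t -> `|h t - h s| <= C * `|t - s| `^ p) ->
      a <= u -> u <= v -> v <= c -> `|h v - h u| <= `|C| * (c - a) `^ p.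
    move=> p0 hh au uv vc.
    apply: (le_trans (hh _ _ (inT _ au (le_trans uv vc)) (inT _ (le_trans au uv) vc))).
    apply: (@le_trans _ _ (`|C| * `|v - u| `^ p)).
      by rewrite ler_wpM2r ?powR_ge0 ?ler_norm.
    rewrite ler_wpM2l// ge0_ler_powR ?nnegrE//; rewrite ?(ltW p0) ?subr_ge0//.
    by rewrite ger0_norm ?subr_ge0// lerB.
  rewrite normrM; have h1 := holder _ _ _ a b beta_gt0 hs (lexx a) ab bc.
  have h2 := holder _ _ _ b c delta_gt0 hg ab bc (lexx c).
  apply: (le_trans (ler_pM _ _ h1 h2)) => //.
  rewrite mulrACA /C1 ler_wpM2l// /ga.
  have [ac0|ac0] := eqVneq (c - a) 0.
    by rewrite ac0 !powR0 ?mul0r ?gt_eqF// addr_gt0.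
  by rewrite powRD// ac0 implybT.
pose K := C1 / (1 - 2 `^ (1 - ga)).
have bis := left_sum_bisection ga1 C10 prod.
exists (`|K| * T `^ (ga - 1) + `|theta| * M).
  by rewrite addr_ge0// mulr_ge0// powR_ge0.
move=> a b a0 ab bT; have aT := ltW (lt_le_trans ab bT).
have [Ib hIb xb] : exists2 I, is_RS_integral sigma g 0 b I &
    x b = x0 - theta * (\int[mu]_(s in `[0, b]) x s) + I.
  by apply: xE; rewrite bT (le_trans a0 (ltW ab)).
have [Ia hIa xa] : exists2 I, is_RS_integral sigma g 0 a I &
    x a = x0 - theta * (\int[mu]_(s in `[0, a]) x s) + I.
  by apply: xE; rewrite a0.
have young : `|Ib - Ia - sigma a * (g b - g a)| <= K * (b - a) `^ ga.
  apply: (RS_integral_increment a0 ab hIa hIb) => k.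
  exact: bis (ltW ab) bT.
have drift : `|\int[mu]_(s in `]a, b]) x s| <= M * (b - a).
  have := @Rintegral_itvoc_dist x a b 0 M ix a0 (ltW ab) bT.
  rewrite mul0r subr0; apply=> s /andP[as_ sb]; rewrite subr0; apply: MP.
  by rewrite (le_trans a0 as_) (le_trans sb).
have -> : x b - x a - sigma a * (g b - g a) =
  (Ib - Ia - sigma a * (g b - g a)) - theta * \int[mu]_(s in `]a, b]) x s.
  by rewrite -(Rintegral_increment ix a0 (ltW ab) bT) xa xb; ring.
apply: (le_trans (ler_normB _ _)); rewrite mulrDl; apply: lerD; last first.
  by rewrite normrM -mulrA ler_wpM2l.
apply: (le_trans young).
apply: (@le_trans _ _ (`|K| * (b - a) `^ ga)).
  by rewrite ler_wpM2r ?powR_ge0 ?ler_norm.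
rewrite -mulrA ler_wpM2l//.
have ba0 : 0 < b - a by rewrite subr_gt0.
have -> : (b - a) `^ ga = (b - a) `^ (ga - 1) * (b - a).
  rewrite -[X in _ * X]powRr1 ?(ltW ba0)// -powRD ?subrK//.
  by apply/implyP => _; rewrite gt_eqF.
rewrite ler_wpM2r ?(ltW ba0)// ge0_ler_powR ?nnegrE ?(ltW ba0) ?(ltW T_gt0)//.
  by rewrite subr_ge0 ltW.
lra.
Qed.

End solution_increment.

(** * Telescoping errors and uniform convergence of monotone functions *)

(** The local error bounds [e * (V (tau l.+1) - V (tau l))] telescope. *)
Lemma telescoping_dist {R : realDomainType} (A V : R -> R) (tau : nat -> R)
  (c : nat -> R) (e : R) (M : nat) :
  (forall l, (l < M)%N ->
    `|A (tau l.+1) - A (tau l) - c l * (V (tau l.+1) - V (tau l))| <=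
    e * (V (tau l.+1) - V (tau l))) ->
  `|A (tau M) - A (tau 0%N) -
     \sum_(0 <= l < M) c l * (V (tau l.+1) - V (tau l))| <=
  e * (V (tau M) - V (tau 0%N)).
Proof.
elim: M => [|M ih] h; first by rewrite big_geq// !subrr normr0 mulr0.
rewrite big_nat_recr//=; set S := \sum_(0 <= l < M) _.
have {}ih := ih (fun l lM => h l (ltnW lM)).
have -> : A (tau M.+1) - A (tau 0%N) - (S + c M * (V (tau M.+1) - V (tau M))) =
  (A (tau M) - A (tau 0%N) - S) +
  (A (tau M.+1) - A (tau M) - c M * (V (tau M.+1) - V (tau M))) by ring.
have -> : e * (V (tau M.+1) - V (tau 0%N)) = e * (V (tau M) - V (tau 0%N)) +
  e * (V (tau M.+1) - V (tau M)) by ring.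
by rewrite (le_trans (ler_normD _ _))// lerD// h.
Qed.

Lemma cvg_natr_powRN {R : realType} (p : R) : 0 < p ->
  n%:R `^ (- p) @[n --> \oo] --> (0 : R).
Proof.
move=> p0; apply/cvgr0Pnorm_le => e e0; near=> n.
rewrite ger0_norm ?powR_ge0// powRN.
have n0 : 0 < n%:R :> R by rewrite ltr0n; near: n; exact: nbhs_infty_gt.
rewrite -[leRHS]invrK lef_pV2 ?posrE ?invr_gt0 ?powR_gt0//.
have -> : e^-1 = (e^-1 `^ p^-1) `^ p.
  by rewrite -powRrM mulVf ?gt_eqF// powRr1// invr_ge0 ltW.
apply: ge0_ler_powR; rewrite ?nnegrE ?powR_ge0//; first exact: ltW.
by near: n; exact: nbhs_infty_ger.
Unshelve. all: by end_near. Qed.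

(** Polya's argument. Monotonicity squeezes [m n t] between the values at the
    two neighbouring grid points, where [F] differs from [F t] by at most
    [L * T / N]. *)
Lemma monotone_grid_uniform {R : realType} (T L : R) (m : nat -> R -> R) (F : R -> R) :
  0 < T -> 0 <= L ->
  (forall n s t, 0 <= s -> s <= t -> t <= T -> m n s <= m n t) ->
  (forall s t, 0 <= s -> s <= t -> t <= T -> 0 <= F t - F s <= L * (t - s)) ->
  (forall N k, (k <= N)%N -> m n (T * (k%:R / N%:R)) @[n --> \oo] --> F (T * (k%:R / N%:R))) ->
  forall e, 0 < e -> \forall n \near \oo, forall t, 0 <= t <= T -> `|F t - m n t| <= e.
Proof.
move=> T0 L0 mono lip cv e e0.
pose N := (Num.truncn (2 * L * T / e)).+1.
have N0 : 0 < N%:R :> R by rewrite ltr0n.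
have LN : L * (T / N%:R) <= e / 2.
  have h : 2 * L * T / e <= N%:R by rewrite ltW// truncnS_gt.
  rewrite ler_pdivrMr// in h; rewrite mulrA ler_pdivrMr//; lra.
pose tau k := T * (k%:R / N%:R).
have near_grid : \forall n \near \oo, forall k, (k < N.+1)%N -> `|F (tau k) - m n (tau k)| <= e / 2.
  have e20 : 0 < e / 2 by rewrite divr_gt0.
  have : \forall n \near \oo, forall k : 'I_N.+1, `|F (tau k) - m n (tau k)| <= e / 2.
    apply: filter_forall => k; have kN : (k <= N)%N by rewrite -ltnS.
    by have /cvgrPdist_le/(_ _ e20) := cv N k kN.
  by apply: filterS => n h k kN; exact: (h (Ordinal kN)).
apply: filterS near_grid => n grid t /andP[t0 tT].
pose k := Num.truncn (t / T * N%:R).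
have tTN0 : 0 <= t / T * N%:R by rewrite mulr_ge0 ?divr_ge0// ltW.
have /andP[k1 k2] := truncn_itv tTN0; rewrite -/k in k1 k2.
have tau_le : tau k <= t.
  have : k%:R / N%:R <= t / T by rewrite ler_pdivrMr.
  by rewrite ler_pdivlMr// mulrC.
have tau_gt : t <= tau k.+1.
  have : t / T <= k.+1%:R / N%:R by rewrite ler_pdivlMr// ltW.
  by rewrite ler_pdivrMr// mulrC.
have kN : (k <= N)%N.
  rewrite -(ler_nat R) (le_trans k1)// ler_piMl ?(ltW N0)//.
  by rewrite ler_pdivrMr// mul1r.
have tau0 j : 0 <= tau j by rewrite mulr_ge0 ?divr_ge0// ltW.
have tauT j : (j <= N)%N -> tau j <= T.
  by move=> jN; rewrite /tau ler_piMr ?(ltW T0)// ler_pdivrMr// mul1r ler_nat.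
have step : tau k.+1 - tau k = T / N%:R by rewrite /tau -natr1; ring.
have gk := grid k kN; have Fk := lip _ _ (tau0 k) tau_le tT.
have mk := mono n _ _ (tau0 k) tau_le tT.
have [kN1|] := ltnP k N; last first.
  move=> Nk; have tE : t = tau k.
    apply/eqP; rewrite eq_le tau_le andbT (le_trans tT)//.
    have -> : k = N by apply/eqP; rewrite eqn_leq kN.
    by rewrite /tau divff ?mulr1// gt_eqF.
  by rewrite tE (le_trans gk)//; lra.
have gk1 := grid k.+1 kN1; have Fk1 := lip _ _ t0 tau_gt (tauT _ kN1).
have mk1 := mono n _ _ t0 tau_gt (tauT _ kN1).
have hL1 : L * (tau k.+1 - t) <= e / 2.
  by apply: le_trans LN; rewrite ler_wpM2l// -step lerB.
have hL2 : L * (t - tau k) <= e / 2.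
  by apply: le_trans LN; rewrite ler_wpM2l// -step lerB.
move: Fk Fk1 gk gk1; rewrite !ler_norml => /andP[? ?] /andP[? ?] /andP[? ?] /andP[? ?].
by apply/andP; split; lra.
Qed.

(** * Quadratic variation of one path of the solution *)

Section pathwise_limit.
Context {R : realType} (T H : R) (T_gt0 : 0 < T) (H_lt1 : H < 1).
Context (sigma g x : R -> R) (beta : R) (beta_gt0 : 0 < beta).
Hypothesis sigma_holder : holder_on `[0, T] beta sigma.
Local Notation mu := (@lebesgue_measure R).

Let f (s : R) := `|sigma s| ^+ 2.

Let f_ge0 s : 0 <= f s. Proof. exact: sqr_ge0. Qed.

Let sigma_bounded : exists2 B : R, 0 <= B & forall s, 0 <= s <= T -> `|sigma s| <= B.
Proof.
have [C hC] := sigma_holder.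
exists (`|sigma 0| + `|C| * T `^ beta); first by rewrite addr_ge0// mulr_ge0// powR_ge0.
move=> s /andP[s0 sT].
have -> : sigma s = sigma 0 + (sigma s - sigma 0) by ring.
apply: (le_trans (ler_normD _ _)); rewrite lerD2l.
have h0 : `[0, T]%classic (0 : R) by rewrite /= in_itv/= lexx ltW.
have hs : `[0, T]%classic s by rewrite /= in_itv/= s0.
apply: (le_trans (hC _ _ h0 hs)); rewrite subr0 [`|s|]ger0_norm//.
apply: (@le_trans _ _ (`|C| * s `^ beta)).
  by rewrite ler_wpM2r ?powR_ge0 ?ler_norm.
apply: ler_wpM2l => //.
by apply: ge0_ler_powR; rewrite ?nnegrE// ?ltW// (le_trans s0).
Qed.

Let f_uniform (e : R) : 0 < e -> exists2 r : R, 0 < r &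
  forall s a, 0 <= s <= T -> 0 <= a <= T -> `|s - a| <= r -> `|f s - f a| <= e.
Proof.
move=> e0; have [C hC] := sigma_holder; have [B B0 hB] := sigma_bounded.
pose K := 2 * B * `|C| + 1.
have K0 : 0 < K by rewrite ltr_wpDl// !mulr_ge0.
exists ((e / K) `^ beta^-1); first by rewrite powR_gt0// divr_gt0.
move=> s a sT aT sa.
have hs : `[0, T]%classic s by rewrite /= in_itv.
have ha : `[0, T]%classic a by rewrite /= in_itv.
have sg : `|sigma s - sigma a| <= `|C| * (e / K).
  apply: (le_trans (hC _ _ ha hs)); apply: (@le_trans _ _ (`|C| * `|s - a| `^ beta)).
    by rewrite ler_wpM2r ?powR_ge0 ?ler_norm.
  rewrite ler_wpM2l//.
  have -> : e / K = ((e / K) `^ beta^-1) `^ beta.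
    by rewrite -powRrM mulVf ?gt_eqF// powRr1// divr_ge0// ltW.
  by apply: ge0_ler_powR; rewrite ?nnegrE ?powR_ge0// ltW.
have -> : f s - f a = (`|sigma s| - `|sigma a|) * (`|sigma s| + `|sigma a|).
  by rewrite /f; ring.
rewrite normrM.
have h1 : `| `|sigma s| - `|sigma a| | <= `|C| * (e / K).
  exact: le_trans (ler_dist_dist _ _) sg.
have h2 : `| `|sigma s| + `|sigma a| | <= 2 * B.
  rewrite ger0_norm ?addr_ge0//; have := hB s sT; have := hB a aT; lra.
apply: (le_trans (ler_pM _ _ h1 h2)) => //.
have -> : `|C| * (e / K) * (2 * B) = e * ((K - 1) / K).
  by rewrite /K; field; rewrite gt_eqF.
rewrite ler_piMr ?(ltW e0)// ler_pdivrMr//; lra.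
Qed.

Let f_bounded : exists2 B : R, 0 <= B & forall s, 0 <= s <= T -> f s <= B.
Proof.
have [B B0 hB] := sigma_bounded; exists (B ^+ 2); first exact: sqr_ge0.
by move=> s sT; rewrite /f lerXn2r ?nnegrE// hB.
Qed.

Let f_integrable : mu.-integrable `[0, T] (EFin \o f).
Proof.
apply: continuous_compact_integrable; first exact: segment_compact.
apply/subspace_continuousP => s sT; apply/cvgrPdist_le => e e0.
have [r r0 hr] := f_uniform e0.
apply/nbhs_ballP; exists r => //= a; rewrite /ball/= => sa aT.
apply: hr; [by move: sT; rewrite /= in_itv|by move: aT; rewrite /= in_itv|].
exact: ltW.
Qed.

Definition energy (t : R) := \int[mu]_(s in `[0, t]) f s.

Let energy0 : energy 0 = 0.
Proof. by rewrite /energy set_itv1 Rintegral_set1. Qed.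

Let energy_dist (a b e : R) : 0 <= a -> a <= b -> b <= T ->
  (forall s, a <= s <= b -> `|f s - f a| <= e) ->
  `|energy b - energy a - f a * (b - a)| <= e * (b - a).
Proof.
move=> a0 ab bT h; rewrite /energy (Rintegral_increment f_integrable)//.
exact: Rintegral_itvoc_dist f_integrable a0 ab bT h.
Qed.

Lemma energy_lipschitz : exists2 L : R, 0 <= L &
  forall s t, 0 <= s -> s <= t -> t <= T -> 0 <= energy t - energy s <= L * (t - s).
Proof.
have [B B0 hB] := f_bounded; exists B => // s t s0 st tT.
rewrite /energy (Rintegral_increment f_integrable)//; apply/andP; split.
  by apply: Rintegral_ge0 => u _; exact: f_ge0.
apply: (le_trans (ler_norm _)).
have := @Rintegral_itvoc_dist _ T f s t 0 B f_integrable s0 st tT.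
rewrite mul0r subr0; apply=> u /andP[su ut]; rewrite subr0 ger0_norm//.
by apply: hB; rewrite (le_trans s0 su) (le_trans ut).
Qed.

Let incr (h : R -> R) (n i : nat) := h (i%:R / n%:R) - h ((i%:R - 1) / n%:R).

Let wsum (n : nat) (c : nat -> R) (t : R) :=
  n%:R `^ (2 * H - 1) * \sum_(1 <= i < (Num.truncn (n%:R * t)).+1) c i.

Let QVE h n t : QV H h n t = wsum n (fun i => `|incr h n i| ^+ 2) t.
Proof. by []. Qed.

Let W (n : nat) (t : R) :=
  wsum n (fun i => f ((i%:R - 1) / n%:R) * `|incr g n i| ^+ 2) t.

Let wsum0 n c : wsum n c 0 = 0.
Proof. by rewrite /wsum mulr0 truncn0 big_geq// mulr0. Qed.

Let wsum_sub n c a b : 0 <= a -> a <= b ->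
  wsum n c b - wsum n c a = n%:R `^ (2 * H - 1) *
    \sum_((Num.truncn (n%:R * a)).+1 <= i < (Num.truncn (n%:R * b)).+1) c i.
Proof.
move=> a0 ab; rewrite /wsum -mulrBr; congr (_ * _).
rewrite (@big_cat_nat _ _ _ (Num.truncn (n%:R * a)).+1 1 (Num.truncn (n%:R * b)).+1)//=.
  by rewrite addrAC subrr add0r.
by rewrite ltnS le_truncn// ler_wpM2l.
Qed.

Let block_index (n i : nat) (a b : R) : (0 < n)%N -> 0 <= a ->
  ((Num.truncn (n%:R * a)).+1 <= i < (Num.truncn (n%:R * b)).+1)%N -> 0 <= b ->
  a < i%:R / n%:R <= b.
Proof.
move=> n0 a0 /andP[ai ib] b0; have n0R : 0 < n%:R :> R by rewrite ltr0n.
apply/andP; split.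
  rewrite ltr_pdivlMr// mulrC; move: ai; rewrite truncn_lt_nat ?mulr_ge0//.
rewrite ler_pdivrMr// mulrC; move: ib; rewrite ltnS truncn_ge_nat ?mulr_ge0//.
Qed.

Lemma QV_nondecreasing (h : R -> R) n s t : 0 <= s -> s <= t ->
  QV H h n s <= QV H h n t.
Proof.
move=> s0 st; rewrite -subr_ge0 !QVE wsum_sub// mulr_ge0 ?powR_ge0//.
by apply: sumr_ge0 => i _; exact: sqr_ge0.
Qed.

(** On an interval of length at most [r] the weights [f] differ from [f a] by at
    most [e]. *)
Let W_block (n : nat) (a b e r : R) : (0 < n)%N -> n%:R^-1 <= r ->
  0 <= a -> a <= b -> b <= T -> b - a <= r ->
  (forall s u : R, 0 <= s <= T -> 0 <= u <= T -> `|s - u| <= r -> `|f s - f u| <= e) ->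
  `|W n b - W n a - f a * (QV H g n b - QV H g n a)| <= e * (QV H g n b - QV H g n a).
Proof.
move=> n0 nr a0 ab bT bar hf; have n0R : 0 < n%:R :> R by rewrite ltr0n.
have b0 := le_trans a0 ab.
rewrite /W !QVE !wsum_sub// mulrCA -mulrBr mulr_sumr -sumrB normrM mulrCA.
rewrite ger0_norm ?powR_ge0// ler_wpM2l ?powR_ge0//.
apply: (le_trans (ler_norm_sum _ _ _)); rewrite mulr_sumr.
apply: ler_sum_nat => i hi; have /andP[ai ib] := block_index n0 a0 hi b0.
rewrite -mulrBl normrM [`| _ ^+ 2|]ger0_norm ?sqr_ge0// ler_wpM2r ?sqr_ge0//.
have i1 : (i%:R - 1) / n%:R = i%:R / n%:R - n%:R^-1 :> R by rewrite mulrBl mul1r.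
have i0 : 0 <= (i%:R - 1) / n%:R :> R.
  rewrite divr_ge0 ?(ltW n0R)// subr_ge0 ler1n.
  by move: hi => /andP[hi _]; exact: leq_ltn_trans hi.
have ninv : 0 <= n%:R^-1 :> R by rewrite invr_ge0.
apply: hf; [rewrite i0/= i1; lra|rewrite a0 (le_trans ab)//|].
by rewrite ler_norml i1; apply/andP; split; lra.
Qed.

(** The squared increments of [g] define measures that converge to the Lebesgue
    measure on the intervals of a grid. Since [f] is nearly constant on these
    intervals, its integrals converge as well. *)
Lemma weighted_QV_cvg (t : R) : 0 < t -> t <= T ->
  (forall M l, (l <= M)%N ->
     QV H g n (t * (l%:R / M%:R)) @[n --> \oo] --> t * (l%:R / M%:R)) ->
  W n t @[n --> \oo] --> energy t.
Proof.
move=> t0 tT cvV; apply/cvgrPdist_le => e0 e00.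
pose e := e0 / (2 * t + 2).
have t20 : 0 < 2 * t + 2 by lra.
have e_gt0 : 0 < e by rewrite divr_gt0.
have [r r0 hr] := f_uniform e_gt0.
pose M := (Num.truncn (t / r)).+1.
have M0 : (0 : R) < M%:R by rewrite ltr0n.
have tMr : t / M%:R <= r.
  by rewrite ler_pdivrMr// mulrC -ler_pdivrMr// ltW// truncnS_gt.
pose tau l := t * (l%:R / M%:R).
have tau0 : tau 0%N = 0 by rewrite /tau mul0r mulr0.
have tauM : tau M = t by rewrite /tau divff ?mulr1// gt_eqF.
have tau_ge0 l : 0 <= tau l by rewrite mulr_ge0 ?divr_ge0// ltW.
have tau_step l : tau l.+1 - tau l = t / M%:R by rewrite /tau -natr1; ring.
have tau_le l : tau l <= tau l.+1 by rewrite -subr_ge0 tau_step divr_ge0// ltW.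
have tau_t l : (l <= M)%N -> tau l <= t.
  by move=> lM; rewrite /tau ler_piMr ?(ltW t0)// ler_pdivrMr// mul1r ler_nat.
pose Gn n := \sum_(0 <= l < M) f (tau l) * (QV H g n (tau l.+1) - QV H g n (tau l)).
pose Goo := \sum_(0 <= l < M) f (tau l) * (tau l.+1 - tau l).
have cvG : Gn n @[n --> \oo] --> Goo.
  rewrite /Gn /Goo big_mkord; under eq_fun do rewrite big_mkord.
  apply: cvg_big => [|l _]; first exact: add_continuous.
  apply: cvgMr.
  by apply: cvgB; apply: cvV; rewrite // ltnW.
have cvt : QV H g n t @[n --> \oo] --> t by have := cvV M M (leqnn M); rewrite -/(tau M) tauM.
have F_close : `|energy t - Goo| <= e * t.
  have := @telescoping_dist _ energy id tau (f \o tau) e M _.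
  rewrite tauM tau0 energy0 !subr0; apply => l lM.
  apply: energy_dist => //; first exact: le_trans (tau_t _ lM) tT.
  move=> s /andP[s1 s2]; have := tau_t _ lM; have := tau_t _ (ltnW lM) => h1 h2.
  have := tau_ge0 l; have := tau_step l => h3 h4.
  apply: hr; rewrite ?(le_trans h4 s1) ?h4/=; [lra|lra|].
  by rewrite ger0_norm ?subr_ge0//; lra.
near=> n.
have n0 : (0 < n)%N by near: n; exact: nbhs_infty_gt.
have nr : n%:R^-1 <= r.
  rewrite -[leRHS]invrK lef_pV2 ?posrE ?invr_gt0 ?ltr0n//.
  by near: n; exact: nbhs_infty_ger.
have W_close : `|W n t - Gn n| <= e * QV H g n t.
  have := @telescoping_dist _ (W n) (QV H g n) tau (f \o tau) e M _.
  rewrite tauM tau0 /W !QVE !wsum0 !subr0 -/(W n t) -!QVE; apply => l lM.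
  apply: (W_block n0 nr) => //; first exact: le_trans (tau_t _ lM) tT.
  by rewrite tau_step.
have Vt : QV H g n t <= t + 1.
  suff : `|t - QV H g n t| <= 1 by rewrite ler_norml => /andP[? ?]; lra.
  by near: n; move/cvgrPdist_le : cvt; apply.
have Gc : `|Goo - Gn n| <= e.
  by near: n; move/cvgrPdist_le : cvG; apply.
have -> : energy t - W n t = (energy t - Goo) + (Goo - Gn n) - (W n t - Gn n) by ring.
apply: (le_trans (ler_normB _ _)).
have h := ler_normD (energy t - Goo) (Goo - Gn n).
have eE : e0 = e * (2 * t + 2) by rewrite /e divfK// gt_eqF.
have eV : e * QV H g n t <= e * (t + 1) by rewrite ler_wpM2l// ltW.
rewrite eE; lra.
Unshelve. all: by end_near. Qed.

Hypothesis x_increment : exists2 C : R, 0 <= C & forall a b,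
  0 <= a -> a < b -> b <= T ->
  `|x b - x a - sigma a * (g b - g a)| <= C * (b - a).

(** By [solution_increment] the increments of [x] and of [g] times [sigma] differ
    by at most [C / n]. The inequality [2 * z * D <= eta * z ^+ 2 + D ^+ 2 / eta]
    splits the difference of the squares into a small multiple of [W n t] and a
    remainder of order [n * n^(2 H - 1) * n^(- 2) = n^(2 H - 2)], which tends
    to 0 as [H < 1]. *)
Lemma QV_solution_cvg (t : R) : 0 <= t -> t <= T ->
  W n t @[n --> \oo] --> energy t ->
  QV H x n t @[n --> \oo] --> energy t.
Proof.
move=> t0 tT cvW; have [C C0 hC] := x_increment.
have en0 : 0 <= energy t by apply: Rintegral_ge0 => s _; exact: f_ge0.
pose err n : R := C ^+ 2 * t * n%:R `^ (- (2 - 2 * H)).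
have cverr : err n @[n --> \oo] --> (0 : R).
  rewrite -(mulr0 (C ^+ 2 * t)); apply: cvgMr; apply: cvg_natr_powRN.
  by have := H_lt1; lra.
have cmp n (eta : R) : (0 < n)%N -> 0 < eta ->
    `|QV H x n t - W n t| <= eta * W n t + (1 + eta^-1) * err n.
  move=> n0 eta0; have n0R : 0 < n%:R :> R by rewrite ltr0n.
  rewrite QVE /W /wsum -mulrBr -sumrB normrM ger0_norm ?powR_ge0//.
  have term i : (1 <= i < (Num.truncn (n%:R * t)).+1)%N ->
    `| `|incr x n i| ^+ 2 - f ((i%:R - 1) / n%:R) * `|incr g n i| ^+ 2| <=
    eta * (f ((i%:R - 1) / n%:R) * `|incr g n i| ^+ 2) +
    (1 + eta^-1) * (C / n%:R) ^+ 2.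
    move=> hi; have /andP[_ it] : (0 : R) < i%:R / n%:R <= t.
      by apply: block_index => //; rewrite mulr0 truncn0.
    have i0 : 0 <= (i%:R - 1) / n%:R :> R.
      by rewrite divr_ge0 ?(ltW n0R)// subr_ge0 ler1n; case/andP: hi.
    have ilt : (i%:R - 1) / n%:R < i%:R / n%:R :> R by rewrite ltr_pM2r ?invr_gt0//; lra.
    have := hC _ _ i0 ilt (le_trans it tT).
    have -> : i%:R / n%:R - (i%:R - 1) / n%:R = n%:R^-1 :> R by ring.
    rewrite -/(incr x n i) -/(incr g n i) /f !real_normK ?num_real//.
    set a := incr x n i; set b := incr g n i; set s := sigma _.
    set c := C / n%:R => hd.
    have hd2 : (a - s * b) ^+ 2 <= c ^+ 2.
      rewrite -[leLHS]real_normK ?num_real// lerXn2r ?nnegrE//.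
      by rewrite /c mulr_ge0// invr_ge0 ltW.
    pose D := a - s * b.
    have -> : a ^+ 2 - s ^+ 2 * b ^+ 2 = 2 * (s * b) * D + D ^+ 2 by rewrite /D; ring.
    apply: (@le_trans _ _ (eta * (s ^+ 2 * b ^+ 2) + (1 + eta^-1) * D ^+ 2)); last first.
      by rewrite lerD2l ler_wpM2l// addr_ge0// invr_ge0 ltW.
    have yg : `|2 * (s * b) * D| <= eta * (s * b) ^+ 2 + eta^-1 * D ^+ 2.
      have key z : 2 * z * D <= eta * z ^+ 2 + eta^-1 * D ^+ 2.
        rewrite -subr_ge0.
        have -> : eta * z ^+ 2 + eta^-1 * D ^+ 2 - 2 * z * D = eta^-1 * (eta * z - D) ^+ 2.
          by field; rewrite gt_eqF.
        by rewrite mulr_ge0 ?sqr_ge0// invr_ge0 ltW.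
      rewrite ler_norml key andbT lerNl.
      by have := key (- (s * b)); rewrite sqrrN mulrN mulNr.
    apply: (le_trans (ler_normD _ _)); rewrite [`|D ^+ 2|]ger0_norm ?sqr_ge0//.
    by move: yg; rewrite exprMn; lra.
  apply: (@le_trans _ _ (n%:R `^ (2 * H - 1) * \sum_(1 <= i < (Num.truncn (n%:R * t)).+1)
     (eta * (f ((i%:R - 1) / n%:R) * `|incr g n i| ^+ 2) + (1 + eta^-1) * (C / n%:R) ^+ 2))).
    rewrite ler_wpM2l ?powR_ge0//; apply: (le_trans (ler_norm_sum _ _ _)).
    exact: ler_sum_nat.
  rewrite big_split/= -mulr_sumr sumr_const_nat subn1/= mulrDr mulrCA lerD2l.
  have Mt : (Num.truncn (n%:R * t))%:R <= n%:R * t :> R.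
    by rewrite truncn_le mulr_ge0// ltW.
  have eta1 : 0 <= 1 + eta^-1 by rewrite addr_ge0// invr_ge0 ltW.
  rewrite -mulrnAr mulrCA ler_wpM2l// -[_ *+ Num.truncn _]mulr_natl /err.
  have -> : n%:R `^ (- (2 - 2 * H)) = n%:R `^ (2 * H - 1) / n%:R.
    rewrite -[n%:R^-1]powR_inv1 ?(ltW n0R)// -powRD; last by apply/implyP => _; rewrite gt_eqF.
    by congr (_ `^ _); ring.
  have -> : C ^+ 2 * t * (n%:R `^ (2 * H - 1) / n%:R) =
    n%:R `^ (2 * H - 1) * (n%:R * t * (C / n%:R) ^+ 2).
    by field; rewrite gt_eqF.
  by rewrite ler_wpM2l ?powR_ge0// ler_wpM2r ?sqr_ge0.
apply/cvgrPdist_le => /= e e0.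
have third k : 0 < k -> k * (e / (3 * k)) = e / 3.
  by move=> k0; field; rewrite gt_eqF.
pose eta : R := e / (3 * (energy t + 1)).
have en1 : 0 < 3 * (energy t + 1) by lra.
have eta0 : 0 < eta by rewrite divr_gt0.
have eta1 : 0 < 1 + eta^-1 by rewrite addr_gt0 ?invr_gt0.
near=> n.
have n0 : (0 < n)%N by near: n; exact: nbhs_infty_gt.
have := cmp n eta n0 eta0.
have Wc : `|energy t - W n t| <= e / 3.
  by near: n; move/cvgrPdist_le : cvW; apply; rewrite divr_gt0.
have W1 : `|energy t - W n t| <= 1 by near: n; move/cvgrPdist_le : cvW; apply.
have errc : `|0 - err n| <= e / (3 * (1 + eta^-1)).
  near: n; move/cvgrPdist_le : cverr; apply; rewrite divr_gt0// mulr_gt0//.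
have errb : (1 + eta^-1) * err n <= e / 3.
  rewrite sub0r normrN in errc.
  apply: le_trans (_ : (1 + eta^-1) * (e / (3 * (1 + eta^-1))) <= _).
    by rewrite ler_wpM2l ?(ltW eta1)// (le_trans (ler_norm _)).
  by rewrite third.
have Wb : eta * W n t <= e / 3.
  apply: le_trans (_ : eta * (energy t + 1) <= _).
    rewrite ler_wpM2l ?(ltW eta0)//; move: W1; rewrite ler_norml => /andP[? ?]; lra.
  by rewrite /eta mulrC third//; lra.
have -> : energy t - QV H x n t = (energy t - W n t) - (QV H x n t - W n t) by ring.
move=> cm; apply: (le_trans (ler_normB _ _)); lra.
Unshelve. all: by end_near. Qed.

Lemma QV_solution_uniform :
  (forall N k, (k <= N)%N ->
     QV H g n (T * (k%:R / N%:R)) @[n --> \oo] --> T * (k%:R / N%:R)) ->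
  forall e, 0 < e ->
  \forall n \near \oo, forall t, 0 <= t <= T -> `|energy t - QV H x n t| <= e.
Proof.
move=> cvV; have [L L0 lip] := energy_lipschitz.
apply: (monotone_grid_uniform T_gt0 L0 _ lip).
  by move=> n s t s0 st _; exact: QV_nondecreasing.
move=> N k kN; set t := T * _.
have t0 : 0 <= t by rewrite mulr_ge0 ?divr_ge0// ltW.
have tT : t <= T.
  rewrite /t ler_piMr ?(ltW T_gt0)//; case: N kN {t t0} => [|N] kN.
    by rewrite invr0 mulr0.
  by rewrite ler_pdivrMr ?ltr0n// mul1r ler_nat.
move: (t0); rewrite le_eqVlt => /predU1P[<-|t_gt0].
  under eq_fun do rewrite QVE wsum0.
  by rewrite energy0; exact: cvg_cst.
apply: QV_solution_cvg => //; apply: weighted_QV_cvg => // M l lM.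
have -> : t * (l%:R / M%:R) = T * ((k * l)%:R / (N * M)%:R).
  by rewrite /t !natrM invfM; ring.
by apply: cvV; exact: leq_mul.
Qed.

End pathwise_limit.

(** * Almost sure uniform convergence *)

Theorem theorem4p3 (R : realType) (d : measure_display)
  (Omega : measurableType d) (P : probability Omega R)
  (H : R) (H_bounds : 0 < H < 3 / 4) (T : R) (T_gt0 : 0 < T)
  (G : R -> {RV P >-> R})
  (G_gaussian : gaussian_process G) (G_centered : centered_process G)
  (G_self_similar : self_similar H G)
  (GA1 : assumptionA1 H G) (GA2 : assumptionA2 H G)
  (GA3 : assumptionA3 H G) (GA4 : assumptionA4 H G)
  (beta : R) (beta_gt : 1 - H < beta)
  (sigma : R -> R) (sigma_holder : holder_on `[0, T] beta sigma)
  (theta x0 : R) (X : R -> {RV P >-> R})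
  (X_solution : {ae P, forall w,
     solves_OU theta sigma x0 T (fun t => G t w) (fun t => X t w)}) :
  {ae P, forall w,
    {uniform `[0, T],
      (fun (n : nat) (t : R) => QV H (fun s => X s w) n t) @ \oo -->
      (fun t : R => \int[lebesgue_measure]_(s in `[0, t]) (`|sigma s| ^+ 2))}}.
Proof.
have /andP[H_gt0 H_lt] := H_bounds.
have H_lt1 : H < 1 by lra.
have beta_gt0 : 0 < beta by lra.
(* [delta] is the midpoint of [max (1 - beta) 0] and [H]. *)
pose delta := (H + Num.max (1 - beta) 0) / 2.
have m0 : 0 <= Num.max (1 - beta) 0 by rewrite le_max lexx orbT.
have m1 : 1 - beta <= Num.max (1 - beta) 0 by rewrite le_max lexx.
have mH : Num.max (1 - beta) 0 < H by rewrite gt_max H_gt0 andbT; lra.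
have delta_gt0 : 0 < delta by rewrite /delta; lra.
have delta_ltH : delta < H by rewrite /delta; lra.
have bd : 1 < beta + delta by rewrite /delta; lra.
have grid : {ae P, forall w, forall N k : nat,
    QV H (fun s => G s w) n (T * (k%:R / N%:R)) @[n --> \oo] --> T * (k%:R / N%:R)}.
  apply: ae_foralln => N; apply: ae_foralln => k.
  apply: QV_fixed_time => //.
  by rewrite mulr_ge0 ?divr_ge0// ltW.
have holder := GA2 delta (introT andP (conj delta_gt0 delta_ltH)).
apply: filterS3 X_solution holder grid => w sol hol cv.
have inc := solution_increment T_gt0 beta_gt0 delta_gt0 bd sigma_holder (hol T T_gt0) sol.
have unif := QV_solution_uniform T_gt0 H_lt1 beta_gt0 sigma_holder inc (fun N k _ => cv N k).
move=> A /uniform_nbhs[E [entE EA]].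
have [e /= e0 eE] : exists2 e : R, 0 < e & forall a b : R, `|a - b| < e -> E (a, b).
  move: entE; rewrite -entourage_ballE => -[e /= e0 eE].
  by exists e => // a b ab; exact: eE.
apply: filterS (unif _ (divr_gt0 e0 (ltr0n _ 2))) => n close.
apply: EA => t; rewrite /= in_itv/= => /close tn.
apply: eE; apply: le_lt_trans tn _; lra.
Qed.
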